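(* Let $R$ be a unique factorization domain such that $\mathrm{SL}_m(R[X_1,\ldots,X_n]) = \mathrm{E}_m(R[X_1,\ldots,X_n])$ for all $n\ge 0$ and all $m\ge 3$. Then every $F\in \mathrm{L}^{(3)}(R)$ (i.e. every origin-preserving automorphism of length three in two variables over $R$) is stably tame.
   Context: For a commutative ring $S$ with $1$, $\mathrm{SL}_m(S)$ is the group of $m\times m$ matrices over $S$ of determinant $1$, and $\mathrm{E}_m(S)$ is the group generated by the elementary $m\times m$ matrices over $S$. A polynomial map over $R$ in $n$ variables is a tuple $F=(F_1,\ldots,F_n)$ with $F_i\in R[X_1,\ldots,X_n]$; composition is by substitution, $F\circ G=(F_1(G_1,\ldots,G_n),\ldots,F_n(G_1,\ldots,G_n))$. $\mathrm{GA}_n(R)$ is the group of polynomial maps invertible under composition (with polynomial inverse over $R$). $\mathrm{Af}_n(R)\subseteq \mathrm{GA}_n(R)$ is the subgroup of affine maps $X\mapsto MX+b$ with $M\in \mathrm{GL}_n(R)$, $b\in R^n$. $\mathrm{EA}_n(R)$ is the subgroup generated by the maps $(X_1,\ldots,X_{i-1},X_i+f,X_{i+1},\ldots,X_n)$ with $1\le i\le n$ and $f\in R[X_1,\ldots,X_n]$ not involving $X_i$. The tame subgroup is $\mathrm{T}_n(R)=\langle \mathrm{Af}_n(R),\mathrm{EA}_n(R)\rangle$. An $F\in \mathrm{GA}_n(R)$ is stably tame if there is $m\in\mathbb{N}$ and new variables $X_{n+1},\ldots,X_{n+m}$ such that $(F,X_{n+1},\ldots,X_{n+m})\in \mathrm{T}_{n+m}(R)$.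 Let $R$ be a domain with fraction field $K$, and write $X,Y$ for the two variables. $\mathrm{GA}_2^0(R)$ is the subgroup of those $F\in \mathrm{GA}_2(R)$ preserving the augmentation, i.e. $F(0,0)=(0,0)$. For $a\in R^*$ put $D_{a,1}=(aX,Y)$. The length of $F\in \mathrm{GA}_2^0(R)$ is the smallest natural number $m$ such that $F=D_{a,1}\circ F_m\circ F_{m-1}\circ\cdots\circ F_1$ for some $a\in R^*$, where each $F_i$ is either of the form $(X,Y+f_i(X))$ with $f_i\in K[X]$, $f_i(0)=0$, or of the form $(X+g_i(Y),Y)$ with $g_i\in K[Y]$, $g_i(0)=0$. $\mathrm{L}^{(m)}(R)$ is the set of $F\in \mathrm{GA}_2^0(R)$ of length $m$. *)

(* Defs.v *)
From HB Require Import structures.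
From mathcomp Require Import all_boot all_order all_algebra.
From mathcomp Require Import mpoly.

Set Implicit Arguments.
Unset Strict Implicit.
Unset Printing Implicit Defensive.

Import GRing.Theory.
Local Open Scope ring_scope.

(* The subgroup generated by S inside the group of invertible elements of a
   monoid (T, op, e).  It is used for matrices under [*m] and for polynomial
   maps under composition, with S consisting of invertible elements; "y is the
   inverse of x" is expressed by the two equations in [gen_inv]. *)
Inductive generated (T : Type) (op : T -> T -> T) (e : T) (S : T -> Prop) :
    T -> Prop :=
  | gen_base x : S x -> generated op e S x
  | gen_one : generated op e S e
  | gen_mul x y :
      generated op e S x -> generated op e S y -> generated op e S (op x y)
  | gen_inv x y :
      generated op e S x -> op x y = e -> op y x = e -> generated op e S y.

Section UniqueFactorization.
Variable R : idomainType.

Definition irreducible_elt (x : R) : Prop :=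
  [/\ x != 0, x \isn't a GRing.unit &
      forall a b : R, x = a * b -> a \is a GRing.unit \/ b \is a GRing.unit].

Definition associated (x y : R) : Prop :=
  exists2 u : R, u \is a GRing.unit & x = u * y.

Definition is_ufd : Prop :=
  (forall x : R, x != 0 -> x \isn't a GRing.unit ->
     exists2 s : seq R,
       (forall p, p \in s -> irreducible_elt p) & x = \prod_(p <- s) p)
  /\
  (forall s t : seq R,
     (forall p, p \in s -> irreducible_elt p) ->
     (forall p, p \in t -> irreducible_elt p) ->
     \prod_(p <- s) p = \prod_(p <- t) p ->
     exists t' : seq R,
       [/\ perm_eq t' t, size t' = size s &
           forall i, (i < size s)%N -> associated s`_i t'`_i]).

End UniqueFactorization.

Section LinearGroups.
Variables (S : comNzRingType) (m : nat).

Definition SL (A : 'M[S]_m) : Prop := \det A = 1.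

Definition elementary_mx (A : 'M[S]_m) : Prop :=
  exists (i j : 'I_m) (a : S), i != j /\ A = 1%:M + a *: delta_mx i j.

(* E_m(S) *)
Definition EL : 'M[S]_m -> Prop :=
  generated (fun A B : 'M[S]_m => A *m B) 1%:M elementary_mx.

End LinearGroups.

Definition polymap (R : nzRingType) (n : nat) := n.-tuple {mpoly R[n]}.

Section PolynomialMaps.
Variable R : comNzRingType.

Definition pm_id (n : nat) : polymap R n := [tuple 'X_i | i < n].

Definition pm_comp (n : nat) (F G : polymap R n) : polymap R n :=
  [tuple tnth F i \mPo G | i < n].

Definition GA (n : nat) (F : polymap R n) : Prop :=
  exists2 G : polymap R n, pm_comp F G = pm_id n & pm_comp G F = pm_id n.

Definition not_involving (n : nat) (i : 'I_n) (f : {mpoly R[n]}) : Prop :=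
  forall m : 'X_{1..n}, m \in msupp f -> m i = 0%N.

Definition elementary_pm (n : nat) (F : polymap R n) : Prop :=
  exists (i : 'I_n) (f : {mpoly R[n]}), not_involving i f /\
    F = [tuple if j == i then 'X_i + f else 'X_j | j < n].

Definition EA (n : nat) : polymap R n -> Prop :=
  generated (@pm_comp n) (pm_id n) (@elementary_pm n).

(* (F_1, ..., F_n, X_{n+1}, ..., X_{n+m}) *)
Definition pm_extend (n m : nat) (F : polymap R n) : polymap R (n + m) :=
  [tuple match split i with
         | inl j => tnth F j \mPo [tuple 'X_(lshift m k) | k < n]
         | inr k => 'X_(rshift n k)
         end | i < n + m].

(* GA^0_n; evaluation at the constant family 0 is evaluation at the origin. *)
Definition GA0 (n : nat) (F : polymap R n) : Prop :=
  GA F /\ forall i : 'I_n, (tnth F i).@[fun=> 0] = 0.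

End PolynomialMaps.

Section Tame.
Variable R : comUnitRingType.

Definition Af (n : nat) (F : polymap R n) : Prop :=
  exists (M : 'M[R]_n) (b : 'cV[R]_n), M \in unitmx /\
    F = [tuple \sum_(j < n) M i j *: 'X_j + (b i 0)%:MP | i < n].

Definition tame (n : nat) : polymap R n -> Prop :=
  generated (@pm_comp R n) (pm_id R n) (fun F => Af F \/ EA F).

Definition stably_tame (n : nat) (F : polymap R n) : Prop :=
  exists m : nat, tame (pm_extend m F).

End Tame.

Section Triangular.
Variable K : fieldType.
Local Notation X := ('X_(inord 0) : {mpoly K[2]}).
Local Notation Y := ('X_(inord 1) : {mpoly K[2]}).

Definition poly_at (n : nat) (f : {poly K}) (q : {mpoly K[n]}) : {mpoly K[n]} :=
  (map_poly (@mpolyC n K) f).[q].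

Definition triangular0 (G : polymap K 2) : Prop :=
  exists f : {poly K}, f.[0] = 0 /\
    (G = [tuple X; Y + poly_at f X] \/ G = [tuple X + poly_at f Y; Y]).

Definition D1 (a : K) : polymap K 2 := [tuple a *: X; Y].

(* D_{a,1} o F_m o ... o F_1 for s = [:: F_m; ...; F_1]. *)
Definition chain (a : K) (s : seq (polymap K 2)) : polymap K 2 :=
  pm_comp (D1 a) (foldr (fun F G => pm_comp F G) (pm_id K 2) s).

End Triangular.

Section Length.
Variable R : idomainType.

Definition frac_field : fieldType := {fraction R}.

Definition to_frac : R -> frac_field := @tofrac R.

(* F viewed as a polynomial map over the fraction field *)
Definition pm_frac (n : nat) (F : polymap R n) : polymap frac_field n :=
  [tuple map_mpoly to_frac (tnth F i) | i < n].

Definition length_factorization (F : polymap R 2) (m : nat) : Prop :=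
  exists (a : R) (s : seq (polymap frac_field 2)),
    [/\ a \is a GRing.unit, size s = m,
        (forall G, G \in s -> triangular0 G) &
        pm_frac F = chain (to_frac a) s].

(* L^(m)(R): the least m admitting a factorization is the length. *)
Definition Lm (m : nat) (F : polymap R 2) : Prop :=
  [/\ GA0 F, length_factorization F m &
      forall k : nat, length_factorization F k -> (m <= k)%N].

End Length.

(* Main.v *)
(** Over the fraction field K a length three map is, up to a diagonal map and
    the swap of the variables, F = (X, Y + f3) o (X + g(Y), Y) o (X, Y + f1).
    Evaluating F and its inverse on the axes shows that g, g(f1) and g(-f3) have
    coefficients in R; comparing leading terms modulo primes, this forces a common
    denominator r of f1 and f3 with g(Y) = h(rY), h over R.  Hence F is conjugate
    under (X, Y) -> (X, rY) to a tame map over R, and it suffices to undo such a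
    conjugation one prime p at a time.  If phi is stably tame and
    phi(X, pY) = (psi_1, p psi_2), then phi(L + pY_0, pY_1, pY_2, ...), minus its
    value at Y = 0 and divided by p, is a tame map in Y and L (each generator of the
    tame group yields a generator).  Since phi(X, 0) is invertible modulo the
    prime p, psi_1 is of degree one in X modulo p, so that an invertible 2 x 2
    matrix over R, acting on L and Y_0, recovers psi from that tame map. *)

Require Import Defs.
From mathcomp Require Import all_boot all_order all_algebra.
From mathcomp Require Import generic_quotient.
From mathcomp Require Import mpoly.
From mathcomp Require Import ring.
From Stdlib Require Import Classical_Prop.

Set Implicit Arguments.
Unset Strict Implicit.
Unset Printing Implicit Defensive.

Import GRing.Theory.
Local Open Scope ring_scope.

(** * Action of polynomial maps on points *)

Lemma eq_mmap (R S : comNzRingType) n (f1 f2 : R -> S) (x1 x2 : 'I_n -> S)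
    (p : {mpoly R[n]}) :
  f1 =1 f2 -> x1 =1 x2 -> mmap f1 x1 p = mmap f2 x2 p.
Proof.
move=> ef ex; rewrite /mmap; apply: eq_bigr => m _.
by rewrite ef (mmap1_eq _ ex).
Qed.

Lemma rmorph_mmap (R S S' : comNzRingType) n (t : {rmorphism S -> S'})
    (f : R -> S) (x : 'I_n -> S) (p : {mpoly R[n]}) :
  t (mmap f x p) = mmap (t \o f) (t \o x) p.
Proof.
rewrite /mmap rmorph_sum; apply: eq_bigr => m _ /=.
rewrite rmorphM /mmap1 rmorph_prod; congr (_ * _).
by apply: eq_bigr => i _; rewrite rmorphXn.
Qed.

Lemma mmap_comp (R S : comNzRingType) n k (f : {rmorphism R -> S})
    (x : 'I_k -> S) (p : {mpoly R[n]}) (q : n.-tuple {mpoly R[k]}) :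
  mmap f x (p \mPo q) = mmap f (fun i => mmap f x (tnth q i)) p.
Proof.
rewrite /comp_mpoly (rmorph_mmap (mmap f x)); apply: eq_mmap => c; last by [].
by rewrite /= mmapC.
Qed.

Lemma mmap_var (R S : comNzRingType) n (f : {rmorphism R -> S}) (x : 'I_n -> S) i :
  mmap f x 'X_i = x i.
Proof. by rewrite mmapX mmap1U. Qed.

Lemma mmapM (R S : comNzRingType) n (f : {rmorphism R -> S}) (x : 'I_n -> S) :
  {morph mmap f x : p q / p * q}.
Proof. exact: rmorphM. Qed.

Section Points.
Variables (R S : comNzRingType) (f : {rmorphism R -> S}).

(** Polynomial maps act on the points of any [R]-algebra [S]. With [S] a polynomial ring and the
    generic point one recovers composition, so identities between maps can be checked by
    evaluation. *)
Definition pm_act n (F : polymap R n) (x : 'I_n -> S) : 'I_n -> S :=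
  fun i => mmap f x (tnth F i).

Lemma pm_act_comp n (F G : polymap R n) x :
  pm_act (pm_comp F G) x =1 pm_act F (pm_act G x).
Proof. by move=> i; rewrite /pm_act tnth_mktuple mmap_comp. Qed.

Lemma pm_act_id n x : pm_act (pm_id R n) x =1 x.
Proof. by move=> i; rewrite /pm_act tnth_mktuple mmap_var. Qed.

Lemma eq_pm_act n (F : polymap R n) x y : x =1 y -> pm_act F x =1 pm_act F y.
Proof. by move=> exy i; apply: eq_mmap. Qed.

(** Ring operations preserve congruence modulo [c]. The witness [w] later supplies the quotients by
    [r] and by [p] in the dilation and in the descent. *)
Lemma mmap_cong n (p : {mpoly R[n]}) c (x y z : 'I_n -> S) :
  (forall i, x i = y i + c * z i) -> exists w, mmap f x p = mmap f y p + c * w.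
Proof.
move=> exy; elim/mpolyind: p => [|a m p _ _ [w ew]].
  by exists 0; rewrite !mmap0 mulr0 addr0.
have [v ev] : exists v, mmap1 x m = mmap1 y m + c * v.
  rewrite /mmap1; elim/big_rec2: _ => [|i s t _ [v ->]].
    by exists 0; rewrite mulr0 addr0.
  suff [u ->] : exists u, x i ^+ m i = y i ^+ m i + c * u.
    by exists (y i ^+ m i * v + u * s + c * u * v); ring.
  elim: (m i) => [|k [u eu]]; first by exists 0; rewrite mulr0 addr0.
  by exists (y i * u + z i * y i ^+ k + c * z i * u); rewrite !exprS eu exy; ring.
exists (f a * v + w).
by rewrite !mmapD !mmapZ !mmapX ev ew; ring.
Qed.

End Points.

Lemma mmap_id (R : comNzRingType) n (p : {mpoly R[n]}) :
  mmap (@mpolyC n R) (fun i => 'X_i) p = p.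
Proof.
by rewrite -[RHS]comp_mpoly_id; apply: eq_mmap => // i; rewrite tnth_mktuple.
Qed.

Lemma tnth_comp (R : comNzRingType) n (F G : polymap R n) i :
  tnth (pm_comp F G) i = pm_act (@mpolyC n R) F (tnth G) i.
Proof. by rewrite tnth_mktuple. Qed.

Lemma pm_comp1 (R : comNzRingType) n (F : polymap R n) : pm_comp F (pm_id R n) = F.
Proof.
apply: eq_from_tnth => i; rewrite tnth_comp /pm_act -[RHS]mmap_id.
by apply: eq_mmap => // j; rewrite tnth_mktuple.
Qed.

Lemma pm_1comp (R : comNzRingType) n (F : polymap R n) : pm_comp (pm_id R n) F = F.
Proof. by apply: eq_from_tnth => i; rewrite tnth_comp pm_act_id. Qed.

Lemma pm_compA (R : comNzRingType) n (F G H : polymap R n) :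
  pm_comp F (pm_comp G H) = pm_comp (pm_comp F G) H.
Proof.
apply: eq_from_tnth => i; rewrite !tnth_comp pm_act_comp; apply: eq_pm_act => j.
by rewrite tnth_comp.
Qed.

(** * Relations of the form phi o d = d o psi *)

Section Intertwining.
Variables (R : comNzRingType) (n : nat).
Implicit Types d F G phi psi : polymap R n.

(** phi' d = phi' d F G = phi' phi d G = d G. *)
Lemma intertwined_inv d phi phi' F G :
  pm_comp phi' phi = pm_id R n -> pm_comp F G = pm_id R n ->
  pm_comp phi d = pm_comp d F -> pm_comp phi' d = pm_comp d G.
Proof.
move=> phiK FG inter.
by rewrite -[d in LHS]pm_comp1 -FG (pm_compA d) -inter !pm_compA phiK pm_1comp.
Qed.

(** d psi psi' = phi d psi' = phi phi' d = d, and [d] cancels on the left. This makes the maps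
    obtained by descent invertible. *)
Lemma intertwined_cancel d phi phi' psi psi' : injective (pm_comp d) ->
  pm_comp phi d = pm_comp d psi -> pm_comp phi' d = pm_comp d psi' ->
  pm_comp phi phi' = pm_id R n -> pm_comp psi psi' = pm_id R n.
Proof.
move=> d_inj E E' phiK; apply: d_inj.
by rewrite pm_compA -E -pm_compA -E' pm_compA phiK pm_1comp pm_comp1.
Qed.

(** d psi e = phi d e = d e F. It allows one factor of a dilation to be treated at a time. *)
Lemma intertwined_compl d e phi psi F : injective (pm_comp d) ->
  pm_comp phi d = pm_comp d psi ->
  pm_comp phi (pm_comp d e) = pm_comp (pm_comp d e) F -> pm_comp psi e = pm_comp e F.
Proof. by move=> d_inj E EF; apply: d_inj; rewrite !pm_compA -E -pm_compA EF. Qed.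

Lemma involution_conj (s A B : polymap R n) :
  pm_comp s s = pm_id R n -> pm_comp A B = pm_id R n ->
  pm_comp (pm_comp s (pm_comp A s)) (pm_comp s (pm_comp B s)) = pm_id R n.
Proof.
move=> ss AB.
have sK : pm_comp s (pm_comp s (pm_comp B s)) = pm_comp B s.
  by apply: etrans (pm_compA _ _ _) _; rewrite ss; exact: pm_1comp.
have AK : pm_comp A (pm_comp B s) = s.
  by apply: etrans (pm_compA _ _ _) _; rewrite AB; exact: pm_1comp.
rewrite -(pm_compA s (pm_comp A s)) -(pm_compA A s).
apply: etrans ss; apply: (congr1 (pm_comp s)).
exact: (etrans (congr1 (pm_comp A) sK) AK).
Qed.

End Intertwining.

(** * Elementary and affine maps *)

(** Invariance under setting X_i to 0 is the form that composes well with substitutions. A monomial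
    containing X_i is sent to 0 and all others are fixed, which gives both directions. *)
Lemma not_involvingP (R : comNzRingType) n (i : 'I_n) (f : {mpoly R[n]}) :
  not_involving i f <->
  mmap (@mpolyC n R) (fun j => if j == i then 0 else 'X_j) f = f.
Proof.
have mE (m : 'X_{1..n}) :
    mmap1 (fun j => if j == i then 0 else 'X_j) m =
    if m i == 0%N then 'X_[m] else 0 :> {mpoly R[n]}.
  case: ifP => [/eqP mi0|mi].
    rewrite -mmap1_id; apply: eq_bigr => j _.
    by case: eqP => // ->; rewrite mi0 !expr0.
  by rewrite /mmap1 (bigD1 i) //= eqxx expr0n mi mul0r.
split=> [fi|ef m].
  rewrite -[RHS]mmap_id; apply: eq_big_seq => m /fi mi.
  by rewrite mE mi eqxx mmap1_id.
rewrite mcoeff_msupp; apply: contraNeq => mi.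
rewrite -ef /mmap raddf_sum big1 ?eqxx //= => m' _.
rewrite mE mcoeffCM; case: ifP => [/eqP m'i|_]; last by rewrite mcoeff0 mulr0.
rewrite mcoeffX; case: eqP => [em|_]; last by rewrite mulr0.
by rewrite -em m'i in mi.
Qed.

Section Tame.
Variable R : comUnitRingType.

Lemma tame_comp n (F G : polymap R n) : tame F -> tame G -> tame (pm_comp F G).
Proof. exact: gen_mul. Qed.

Lemma tame_elementary n (i : 'I_n) (f : {mpoly R[n]}) (F : polymap R n) :
  mmap (@mpolyC n R) (fun j => if j == i then 0 else 'X_j) f = f ->
  tnth F i = 'X_i + f -> (forall j, j != i -> tnth F j = 'X_j) -> tame F.
Proof.
move=> /not_involvingP fi Fi Fj; apply: gen_base; right; apply: gen_base.
exists i, f; split=> //; apply: eq_from_tnth => j; rewrite tnth_mktuple.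
by case: eqP => [->|/eqP/Fj].
Qed.

(** * Affine maps in a subset of the variables *)

Section Embedding.
Variables (n k : nat) (e : 'I_n -> 'I_k).
Hypothesis e_inj : injective e.

Let back (b : 'I_k) : option 'I_n := [pick j | e j == b].

Let backK j : back (e j) = Some j.
Proof.
rewrite /back; case: pickP => [j' /eqP/e_inj -> //|/(_ j)].
by rewrite eqxx.
Qed.

Let back_Some b j : back b = Some j -> b = e j.
Proof. by rewrite /back; case: pickP => // j' /eqP <- [->]. Qed.

(** Up to a permutation of the coordinates this is the block diagonal matrix of [M] and the
    identity. *)
Definition emb_mx (M : 'M[R]_n) : 'M[R]_k :=
  \matrix_(a, b) match back a, back b with
                 | Some i, Some j => M i j
                 | _, _ => (a == b)%:R
                 end.

Lemma emb_sum (V : zmodType) (h : 'I_k -> V) :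
  (forall b, back b = None -> h b = 0) -> \sum_b h b = \sum_j h (e j).
Proof.
move=> h0; rewrite (bigID (mem (codom e))) /= [X in _ + X]big1 ?addr0; last first.
  move=> b be; apply: h0; case E: (back b) => [j|//].
  by rewrite (back_Some E) codom_f in be.
rewrite -(big_map e xpredT h).
rewrite -[RHS](big_filter) filter_predT.
rewrite -big_filter; apply: perm_big; apply: uniq_perm.
- by rewrite filter_uniq // index_enum_uniq.
- by rewrite map_inj_uniq // index_enum_uniq.
move=> b; rewrite mem_filter mem_index_enum andbT.
apply/codomP/mapP => [[j ->]|[j _ ->]]; exists j => //.
exact: mem_index_enum.
Qed.

Lemma emb_mxM M N : emb_mx M *m emb_mx N = emb_mx (M *m N).
Proof.
apply/matrixP => a c; rewrite !mxE.
case Ea: (back a) => [i|]; last first.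
  rewrite (bigD1 a) //= !mxE Ea eqxx mul1r big1 ?addr0 // => b ba.
  by rewrite !mxE Ea eq_sym (negbTE ba) mul0r.
case Ec: (back c) => [j|]; last first.
  rewrite (bigD1 c) //= !mxE Ea Ec eqxx mulr1 big1 ?addr0 // => b bc.
  by rewrite !mxE Ec (negbTE bc); case: (back b) => *; rewrite mulr0.
rewrite emb_sum ?mxE => [|b Eb].
  by apply: eq_bigr => l _; rewrite !mxE Ea Ec backK.
rewrite !mxE Ea Eb; case: eqP => [ab|]; last by rewrite mul0r.
by rewrite -ab Ea in Eb.
Qed.

Lemma emb_mx1 : emb_mx 1%:M = 1%:M.
Proof.
apply/matrixP => a c; rewrite !mxE.
case Ea: (back a) => [i|//]; case Ec: (back c) => [j|//].
by rewrite !mxE (back_Some Ea) (back_Some Ec) (inj_eq e_inj).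
Qed.

Lemma tame_affine (M : 'M[R]_n) (b : 'I_n -> R) (F : polymap R k) :
  M \in unitmx ->
  (forall i, tnth F (e i) = \sum_j (M i j)%:MP * 'X_(e j) + (b i)%:MP) ->
  (forall c, c \notin codom e -> tnth F c = 'X_c) -> tame F.
Proof.
move=> Mu Fe Fc; apply: gen_base; left.
exists (emb_mx M), (\col_c (if back c is Some i then b i else 0)); split.
  have : emb_mx M *m emb_mx (invmx M) = 1%:M by rewrite emb_mxM mulmxV ?emb_mx1.
  by case/mulmx1_unit.
apply: eq_from_tnth => c; rewrite tnth_mktuple mxE.
case Ec: (back c) => [i|]; last first.
  rewrite Fc; last first.
    by apply/negP => /codomP[j cj]; rewrite cj backK in Ec.
  rewrite (bigD1 c) //= mxE Ec eqxx scale1r big1 ?addr0 ?mpolyC0 ?addr0 //.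
  by move=> d dc; rewrite mxE Ec eq_sym (negbTE dc) scale0r.
rewrite (back_Some Ec) Fe; congr (_ + _); rewrite emb_sum => [|d Ed].
  by apply: eq_bigr => l _; rewrite mxE !backK mul_mpolyC.
rewrite mxE backK Ed; case: eqP => [ed|]; last by rewrite scale0r.
by rewrite -ed backK in Ed.
Qed.

End Embedding.

(** The primed scalars are the entries of a right inverse of the matrix, which over a commutative
    ring is a two-sided inverse. *)
Lemma tame_linear2 n (i j : 'I_n) (a b c d a' b' c' d' s t : R) (F : polymap R n) :
  i != j ->
  a * a' + b * c' = 1 -> a * b' + b * d' = 0 ->
  c * a' + d * c' = 0 -> c * b' + d * d' = 1 ->
  tnth F i = a%:MP * 'X_i + b%:MP * 'X_j + s%:MP ->
  tnth F j = c%:MP * 'X_i + d%:MP * 'X_j + t%:MP ->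
  (forall l, l != i -> l != j -> tnth F l = 'X_l) -> tame F.
Proof.
move=> ij e11 e12 e21 e22 Fi Fj Fl.
pose e (l : 'I_2) := if l == 0 then i else j.
have e_inj : injective e.
  move=> x y; rewrite /e.
  case: (unliftP 0 x) => [x'|] ->; case: (unliftP 0 y) => [y'|] -> //=.
  - by rewrite !ord1.
  - by move/eqP; rewrite eq_sym (negbTE ij).
  - by move/eqP; rewrite (negbTE ij).
pose M4 (x y z w : R) : 'M[R]_2 := \matrix_(k, l)
  (if k == 0 then (if l == 0 then x else y) else if l == 0 then z else w).
apply: (@tame_affine 2 n e e_inj (M4 a b c d) (fun l => if l == 0 then s else t)).
- suff /mulmx1_unit[] : M4 a b c d *m M4 a' b' c' d' = 1%:M by [].
  apply/matrixP => x y; rewrite !mxE big_ord_recl big_ord1 !mxE /=.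
  case: (unliftP 0 x) => [x'|] ->; case: (unliftP 0 y) => [y'|] -> //=.
  by rewrite !ord1 eqxx.
- move=> x; rewrite big_ord_recl big_ord1 !mxE /e /=.
  by case: (unliftP 0 x) => [x'|] ->.
- move=> l le; apply: Fl; apply: contraNneq le => ->.
    by apply/codomP; exists 0.
  by apply/codomP; exists 1.
Qed.

End Tame.

(** * Dilation along a curve *)

Section Dilation.
Variables (R : idomainType) (r : R) (n : nat).
Hypothesis r_neq0 : r != 0.

Local Notation S := {mpoly R[n.+1]}.
Local Notation L := (@ord_max n).
Local Notation W := (lift (@ord_max n)).
Local Notation act := (@pm_act R S (@mpolyC n.+1 R) n).

(* [a] depends on the variable L only. *)
Definition param (a : S) :=
  forall t : polymap R n.+1, tnth t L = 'X_L -> mmap (@mpolyC _ R) (tnth t) a = a.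

(** The map [t] is (g(a + rY) - g(a)) / r in the variables Y, with L as a parameter. The equation is
    multiplied by [r] to stay inside the ring; since [r] is regular, it determines [t]. *)
Definition dilation_lift (g : polymap R n) (a : 'I_n -> S) (t : polymap R n.+1) :=
  tnth t L = 'X_L /\
  forall i, act g (fun j => a j + r%:MP * 'X_(W j)) i = act g a i + r%:MP * tnth t (W i).

(** All curves [a] are allowed because composition and inversion move the base curve: the property
    is then stable under both. *)
Definition dilation_tame g :=
  forall a, (forall i, param (a i)) -> forall t, dilation_lift g a t -> tame t.

Lemma mulrC_inj : injective (fun x : S => r%:MP * x).
Proof. by apply: mulfI; rewrite mpolyC_eq0. Qed.

Lemma ordS_ind (P : 'I_n.+1 -> Prop) : P L -> (forall i, P (W i)) -> forall i, P i.
Proof. by move=> PL PW i; case: (unliftP L i) => [j|] ->. Qed.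

Lemma act_subst (t : polymap R n.+1) (g : polymap R n) (a : 'I_n -> S) i :
  mmap (@mpolyC _ R) (tnth t) (act g a i) =
  act g (fun j => mmap (@mpolyC _ R) (tnth t) (a j)) i.
Proof.
rewrite /pm_act (rmorph_mmap (mmap (@mpolyC n.+1 R) (tnth t))).
by apply: eq_mmap => // c; rewrite /= mmapC.
Qed.

Lemma param_act g a : (forall i, param (a i)) -> forall i, param (act g a i).
Proof.
by move=> pa i t tL; rewrite act_subst; apply: eq_pm_act => j; rewrite pa.
Qed.

Lemma dilation_lift_exists g a : exists t, dilation_lift g a t.
Proof.
have /fin_all_exists[w ew] : forall i, exists w : S,
    act g (fun j => a j + r%:MP * 'X_(W j)) i = act g a i + r%:MP * w.
  by move=> i; apply: mmap_cong.
exists [tuple if unlift L i is Some j then w j else 'X_L | i < n.+1].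
split; first by rewrite tnth_mktuple unlift_none.
by move=> i; rewrite tnth_mktuple liftK.
Qed.

(** Substitute [s] in the equation that defines the lift. As [s] fixes L, it leaves [a] and g(a)
    unchanged. *)
Lemma dilation_liftP g a t s : (forall i, param (a i)) -> dilation_lift g a t ->
  tnth s L = 'X_L -> forall i,
  act g (fun j => a j + r%:MP * tnth s (W j)) i =
    act g a i + r%:MP * tnth (pm_comp t s) (W i).
Proof.
move=> pa [tL et] sL i; move: (et i) => /(congr1 (mmap (@mpolyC _ R) (tnth s))).
rewrite mmapD mmapM [mmap _ _ r%:MP]mmapC [X in _ = X + _](param_act g pa i sL).
rewrite act_subst tnth_comp => <-.
by apply: eq_pm_act => j; rewrite mmapD mmapM mmapC (pa j s sL) mmap_var.
Qed.

Lemma lift_comp_L t s :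
  tnth t L = 'X_L -> tnth s L = 'X_L -> tnth (pm_comp t s) L = 'X_L :> S.
Proof. by move=> tL sL; rewrite tnth_comp /pm_act tL mmap_var. Qed.

Lemma dilation_tame_id : dilation_tame (pm_id R n).
Proof.
move=> a pa t [tL et]; suff -> : t = pm_id R n.+1 by exact: gen_one.
apply: eq_from_tnth; apply: ordS_ind => [|i]; first by rewrite tL tnth_mktuple.
by apply: mulrC_inj; apply: (@addrI _ (a i)); move: (et i); rewrite !pm_act_id tnth_mktuple.
Qed.

(** A chain rule: the lift of g o h along [a] is the lift of [g] along h(a) composed with the lift
    of [h] along [a]. *)
Lemma dilation_tame_comp g h :
  dilation_tame g -> dilation_tame h -> dilation_tame (pm_comp g h).
Proof.
move=> Tg Th a pa t [tL et].
have [th lh] := dilation_lift_exists h a.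
have [tg lg] := dilation_lift_exists g (act h a).
suff -> : t = pm_comp tg th.
  apply: tame_comp; first by apply: Tg lg => i; apply: param_act.
  exact: Th lh.
apply: eq_from_tnth; apply: ordS_ind => [|i].
  by rewrite (lift_comp_L _ lh.1) ?tL // lg.1.
apply: mulrC_inj; apply: (@addrI _ (act g (act h a) i)) => /=.
rewrite -(dilation_liftP _ lg lh.1); last exact: param_act.
by rewrite -pm_act_comp -et pm_act_comp; apply: eq_pm_act => j; rewrite lh.2.
Qed.

(** The lift of [h] along [a] is inverse to the lift of [g] along h(a), because g(h(a)) = a. *)
Lemma dilation_tame_inv g h :
  dilation_tame g -> pm_comp g h = pm_id R n -> pm_comp h g = pm_id R n ->
  dilation_tame h.
Proof.
move=> Tg gh hg a pa t lt.
have pha : forall i, param (act h a i) by apply: param_act.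
have [s ls] := dilation_lift_exists g (act h a).
have gha i : act g (act h a) i = a i by rewrite -pm_act_comp gh pm_act_id.
apply: (gen_inv (Tg _ pha _ ls)); apply: eq_from_tnth; apply: ordS_ind => [|i].
- by rewrite lift_comp_L ?tnth_mktuple ?ls.1 ?lt.1.
- apply: mulrC_inj; apply: (@addrI _ (a i)) => /=.
  rewrite -[in LHS]gha -(dilation_liftP pha ls lt.1) tnth_mktuple.
  transitivity (act (pm_comp g h) (fun j => a j + r%:MP * 'X_(W j)) i).
    by rewrite pm_act_comp; apply: eq_pm_act => j; rewrite lt.2.
  by rewrite gh pm_act_id.
- by rewrite lift_comp_L ?tnth_mktuple ?ls.1 ?lt.1.
apply: mulrC_inj; apply: (@addrI _ (act h a i)) => /=.
rewrite -(dilation_liftP pa lt ls.1) tnth_mktuple.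
transitivity (act (pm_comp h g) (fun j => act h a j + r%:MP * 'X_(W j)) i).
  by rewrite pm_act_comp; apply: eq_pm_act => j; rewrite ls.2 gha.
by rewrite hg pm_act_id.
Qed.

Lemma dilation_tame_elementary g : elementary_pm g -> dilation_tame g.
Proof.
case=> i [f [/not_involvingP fi eg]] a pa t [tL et].
have gi : tnth g i = 'X_i + f by rewrite eg tnth_mktuple eqxx.
have gj j : j != i -> tnth g j = 'X_j.
  by move=> ji; rewrite eg tnth_mktuple (negbTE ji).
pose b j := a j + r%:MP * 'X_(W j).
(* The lift adds e = (f(a + rY) - f(a)) / r to Y_i. Since [f] does not involve X_i and [a] involves
   only L, [e] does not involve Y_i, so the lift is elementary. *)
pose e := tnth t (W i) - 'X_(W i).
have re : r%:MP * e = mmap (@mpolyC n.+1 R) b f - mmap (@mpolyC n.+1 R) a f.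
  have := et i; rewrite /pm_act gi !mmapD !mmap_var /e -/b mulrBr => E.
  have -> : r%:MP * tnth t (W i) = b i + mmap (@mpolyC n.+1 R) b f -
      (a i + mmap (@mpolyC n.+1 R) a f) by rewrite E; ring.
  by rewrite /b; move: (mmap _ _ _) (mmap _ _ _) => *; ring.
apply: (@tame_elementary _ _ (W i) e) => [||].
- pose z := fun j => if j == W i then 0 else 'X_j : S.
  have fE c : mmap (@mpolyC n.+1 R) c f =
      mmap (@mpolyC n.+1 R) (fun j => if j == i then 0 else c j) f.
    rewrite -[in LHS]fi (rmorph_mmap (mmap (@mpolyC n.+1 R) c)).
    apply: eq_mmap => j /=; first by rewrite mmapC.
    by case: eqP => _; rewrite ?rmorph0 ?mmap_var.
  have za j : mmap (@mpolyC n.+1 R) z (a j) = a j.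
    rewrite -[RHS](pa j [tuple z j | j < n.+1]).
      by apply: eq_mmap => // l; rewrite tnth_mktuple.
    by rewrite tnth_mktuple /z (negbTE (neq_lift _ _)).
  apply: mulrC_inj => /=; rewrite -[LHS]/(r%:MP * mmap (@mpolyC n.+1 R) z e).
  have rz : mmap (@mpolyC n.+1 R) z r%:MP = r%:MP by rewrite mmapC.
  rewrite -{1}rz -rmorphM /= re rmorphB /=.
  congr (_ - _); last first.
    rewrite (rmorph_mmap (mmap (@mpolyC n.+1 R) z)).
    by apply: eq_mmap => j /=; rewrite ?mmapC ?za.
  rewrite fE (rmorph_mmap (mmap (@mpolyC n.+1 R) z)).
  apply: eq_mmap => j /=; first by rewrite mmapC.
  case: eqP => [_|/eqP ji]; first by rewrite rmorph0.
  rewrite rmorphD rmorphM /= za mmapC mmap_var.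
  by rewrite /z (inj_eq lift_inj) (negbTE ji).
- by rewrite /e [RHS]addrC subrK.
apply: ordS_ind => [|j] // ji; apply: mulrC_inj; apply: (@addrI _ (a j)) => /=.
have := et j; rewrite /pm_act gj ?mmap_var //.
by apply: contraNneq ji => ->.
Qed.

(** The translation part cancels in g(a + rY) - g(a), and what remains after division by [r] is the
    linear map of matrix [M] on the variables Y. *)
Lemma dilation_tame_affine g : Af g -> dilation_tame g.
Proof.
case=> M [v [Mu eg]] a pa t [tL et].
apply: (@tame_affine _ n n.+1 W lift_inj M (fun=> 0)) => // [i|c Wc].
  rewrite mpolyC0 addr0; apply: mulrC_inj; apply: (@addrI _ (act g a i)) => /=.
  rewrite -et mulr_sumr.
  have gE (b : 'I_n -> S) :
      act g b i = \sum_j (M i j)%:MP * b j + (v i 0)%:MP.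
    rewrite /pm_act eg tnth_mktuple rmorphD /= mmapC rmorph_sum; congr (_ + _).
    by apply: eq_bigr => j _; rewrite /= mmapZ mmap_var.
  rewrite !gE addrAC; congr (_ + _); rewrite -big_split; apply: eq_bigr => j _ /=.
  by ring.
case: (unliftP L c) Wc => [j|] -> //.
by rewrite codom_f.
Qed.

Lemma tame_dilation g : tame g -> dilation_tame g.
Proof.
elim=> {g} [g [/dilation_tame_affine //|]|||].
- elim=> {g} [g /dilation_tame_elementary //|||].
  + exact: dilation_tame_id.
  + by move=> *; apply: dilation_tame_comp.
  + by move=> g h _ Tg gh hg; apply: dilation_tame_inv gh hg.
- exact: dilation_tame_id.
- by move=> *; apply: dilation_tame_comp.
by move=> g h _ Tg gh hg; apply: dilation_tame_inv gh hg.
Qed.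

End Dilation.

(** * Polynomials modulo a prime *)

Section Primes.
Variable R : idomainType.

Definition divides (d x : R) := exists y, x = d * y.

Definition prime_elt (p : R) :=
  [/\ p != 0, p \isn't a GRing.unit &
      forall a b, divides p (a * b) -> divides p a \/ divides p b].

Lemma divides_associated p q : associated p q -> divides p q.
Proof. by case=> u Uu ->; exists u^-1; rewrite mulrC mulKr. Qed.

Lemma divides_prod p (s : seq R) : p \in s -> divides p (\prod_(q <- s) q).
Proof. by move=> ps; rewrite (big_rem p ps); exists (\prod_(q <- rem p s) q). Qed.

Lemma divides_trans q p r : divides p q -> divides q r -> divides p r.
Proof. by case=> x -> [y ->]; exists (x * y); rewrite mulrA. Qed.

Lemma irreducible_prime (p : R) : is_ufd R -> irreducible_elt p -> prime_elt p.
Proof.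
move=> [fact uniq] irr_p; have [p0 pU p_irr] := irr_p; split=> // a b [c abE].
have [->|a0] := eqVneq a 0; first by left; exists 0; rewrite mulr0.
have [->|b0] := eqVneq b 0; first by right; exists 0; rewrite mulr0.
have [Ua|/(fact a a0)[s s_irr sE]] := boolP (a \is a GRing.unit).
  by right; exists (a^-1 * c); rewrite mulrCA -abE mulKr.
have [Ub|/(fact b b0)[t t_irr tE]] := boolP (b \is a GRing.unit).
  by left; exists (b^-1 * c); rewrite mulrCA -abE [a * b]mulrC mulKr.
have c0 : c != 0 by apply: contraTneq (mulf_neq0 a0 b0) => c0; rewrite abE c0 mulr0 eqxx.
(* Unique factorization is stated for products of irreducibles without a unit factor. If [c] is a
   unit it is therefore absorbed into [p], giving p' = p c and no further factors. *)
have [p' [u [p'_irr pp' u_irr pcE]]] : exists p' u, [/\ irreducible_elt p', associated p p',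
    forall q, q \in u -> irreducible_elt q & p * c = p' * \prod_(q <- u) q].
  have [Uc|/(fact c c0)[u u_irr uE]] := boolP (c \is a GRing.unit); last first.
    exists p, u; split=> //; last by rewrite uE.
    by exists 1; rewrite ?unitr1 ?mul1r.
  exists (p * c), [::]; split; rewrite ?big_nil ?mulr1 //.
    split; rewrite ?mulf_neq0 ?unitrM ?Uc ?andbT // => x y pcE.
    have [|Ux|] := p_irr x (y / c); first by rewrite mulrA -pcE mulrK.
      by left.
    by rewrite unitrM => /andP[Uy _]; right.
  by exists c^-1; rewrite ?unitrV // mulrC mulrK.
have [||| t' [t'_perm st' t'_ass]] := uniq (p' :: u) (s ++ t).
- by move=> q; rewrite inE => /predU1P[->//|/u_irr].
- by move=> q; rewrite mem_cat => /orP[/s_irr|/t_irr].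
- by rewrite big_cons big_cat -pcE -abE sE tE.
(* Index 0 is the position of [p'] in [p' :: u]; the irreducible matched with it is a factor of [a]
   or of [b]. *)
have /divides_associated p'q := t'_ass 0%N isT.
have {p'q} pq := divides_trans (divides_associated pp') p'q.
have : t'`_0 \in s ++ t by rewrite -(perm_mem t'_perm) mem_nth ?st'.
rewrite mem_cat => /orP[/divides_prod|/divides_prod] qD.
  by left; rewrite sE; apply: divides_trans qD.
by right; rewrite tE; apply: divides_trans qD.
Qed.

Variable p : R.
Hypothesis p_prime : prime_elt p.

Let p_neq0 : p != 0. Proof. by case: p_prime. Qed.

Lemma prime_ndvd1 : ~ divides p 1.
Proof.
case: p_prime => _ /negP pU _ [c c1]; apply: pU.
by apply/unitrPr; exists c.
Qed.

Lemma prime_ndvdX x n : ~ divides p x -> ~ divides p (x ^+ n).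
Proof.
move=> px; elim: n => [|n IHn]; first exact: prime_ndvd1.
by rewrite exprS; case: p_prime => _ _ /[apply] -[].
Qed.

Definition pdivides (d : R) (A : {poly R}) := exists B, A = d *: B.

Lemma pdivides_coef A n : pdivides p A -> divides p A`_n.
Proof. by case=> B ->; exists B`_n; rewrite coefZ. Qed.

(** This replaces the passage to polynomials over the quotient by [p]: leading terms divisible by
    [p] are moved into [h], until the leading coefficient of what remains survives modulo [p]. *)
Lemma prime_reduction (f : {poly R}) : exists g h,
  f = g + p *: h /\ (g = 0 \/ ~ divides p (lead_coef g)).
Proof.
have [n] := ubnP (size f); elim: n f => // n IHn f; rewrite ltnS => sf.
have [->|f0] := eqVneq f 0; first by exists 0, 0; rewrite scaler0 addr0; split=> //; left.
case: (classic (divides p (lead_coef f))) => [[c fc]|]; last first.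
  by exists f, 0; rewrite scaler0 addr0; split=> //; right.
have [|g [h [gh g_lead]]] := IHn (f - lead_coef f *: 'X^((size f).-1)).
  apply: leq_trans sf; rewrite -[in X in (_ < X)%N](prednK (n := size f)) ?size_poly_gt0 //.
  rewrite ltnS.
  apply/leq_sizeP => j; rewrite leq_eqVlt => /predU1P[<-|sj].
    by rewrite coefB coefZ coefXn eqxx mulr1 subrr.
  rewrite coefB coefZ coefXn gtn_eqF // mulr0 subr0 nth_default //.
  by rewrite (leq_trans (leqSpred _)).
exists g, (h + c *: 'X^((size f).-1)); split=> //.
by rewrite scalerDr scalerA -fc addrA -gh subrK.
Qed.

Lemma comp_poly_cong (H u v : {poly R}) :
  exists w, H \Po (u + p *: v) = H \Po u + p *: w.
Proof.
elim/poly_ind: H => [|H c [w ew]]; first by exists 0; rewrite !comp_poly0 scaler0 addr0.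
exists (w * u + (H \Po u) * v + p *: (w * v)).
by rewrite !comp_poly_MXaddC ew -!mul_polyC; ring.
Qed.

(** Modulo [p], the polynomial [A] is nonzero without constant term, hence nonconstant. Over a
    domain, composing a nonzero polynomial with a nonconstant one cannot give zero, as the leading
    coefficient of the composite shows. *)
Lemma pdivides_comp (H A : {poly R}) :
  A.[0] = 0 -> ~ pdivides p A -> pdivides p (H \Po A) -> pdivides p H.
Proof.
have [A1 [A2 [EA A_lead]]] := prime_reduction A.
have [H1 [H2 [EH H_lead]]] := prime_reduction H.
move=> A0 pA [B HA]; case: H_lead => [H10|H_lead].
  by exists H2; rewrite EH H10 add0r.
case: A_lead => [A10|A_lead]; first by case: pA; exists A2; rewrite EA A10 add0r.
(* If [A1] were constant, A(0) = 0 would make this constant a multiple of [p]. *)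
have sA : (1 < size A1)%N.
  rewrite ltnNge; apply/negP => sA; apply: A_lead.
  rewrite (size1_polyC sA) lead_coefC; exists (- A2.[0]).
  move/eqP: A0; rewrite EA (size1_polyC sA) !hornerE /= coefC eqxx mulrN addr_eq0.
  by move/eqP.
have [w ew] := comp_poly_cong H1 A1 A2.
have : pdivides p (H1 \Po A1).
  exists (B - (H2 \Po A) - w); rewrite !scalerBr -HA EH comp_polyD comp_polyZ.
  by rewrite addrK EA ew addrK.
move/(pdivides_coef (size (H1 \Po A1)).-1); rewrite -/(lead_coef _) lead_coef_comp //.
by case: p_prime => _ _ /[apply] -[//|/(prime_ndvdX A_lead)].
Qed.

(** Degrees multiply under composition over a domain, so a polynomial with a left inverse modulo [p]
    has degree one modulo [p]. Its slope [a] is then a unit modulo [p], with inverse [a']. *)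
Lemma invertible_mod_prime (P Q : {poly R}) : pdivides p (Q \Po P - 'X) ->
  exists a b a' c h, P = a *: 'X + b%:P + p *: h /\ a * a' + p * c = 1.
Proof.
case=> B QPX.
have [P1 [P2 [EP P_lead]]] := prime_reduction P.
have [Q1 [Q2 [EQ Q_lead]]] := prime_reduction Q.
have [w ew] := comp_poly_cong Q1 P1 P2.
have {B QPX ew} [B QPX] : pdivides p (Q1 \Po P1 - 'X).
  exists (B - (Q2 \Po P) - w); rewrite !scalerBr -QPX EQ comp_polyD comp_polyZ.
  by rewrite EP ew; set u := _ \Po _; set v := _ \Po _; ring.
have coefE k : (Q1 \Po P1)`_k = (k == 1%N)%:R + p * B`_k.
  by rewrite -coefZ -QPX coefB coefX addrC subrK.
(* For constant [P1] the coefficient of X in the composite would be 0, and [p] would divide 1. *)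
have sP : (1 < size P1)%N.
  rewrite ltnNge; apply/negP => sP; apply: prime_ndvd1; exists (- B`_1).
  have := coefE 1%N; rewrite (size1_polyC sP) comp_polyCr coefC /= => /esym/eqP.
  by rewrite addr_eq0 mulrN => /eqP.
have Q10 : Q1 != 0.
  apply: contra_not_neq prime_ndvd1 => Q10; exists (- B`_1).
  have := coefE 1%N; rewrite Q10 comp_poly0 coef0 => /esym/eqP.
  by rewrite addr_eq0 mulrN => /eqP.
case: Q_lead => [/eqP|Q_lead]; first by rewrite (negbTE Q10).
case: P_lead => [P10|P_lead]; first by rewrite P10 size_poly0 in sP.
have lead_dvd : ~ divides p (lead_coef (Q1 \Po P1)).
  by rewrite lead_coef_comp //; case: p_prime => _ _ /[apply] -[//|/(prime_ndvdX P_lead)].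
(* All coefficients of the composite other than that of X are divisible by [p], whereas its leading
   coefficient is not. *)
have sQP : size (Q1 \Po P1) = 2%N.
  case: (eqVneq (size (Q1 \Po P1)).-1 1%N) => [|sne].
    by case: (size _) => [|[]] //= n [->].
  case: lead_dvd; exists B`_((size (Q1 \Po P1)).-1).
  by rewrite /lead_coef coefE (negbTE sne) add0r.
have [sQ sP2] : size Q1 = 2%N /\ size P1 = 2%N.
  have := size_comp_poly Q1 P1; rewrite sQP /= => /esym/eqP.
  rewrite muln_eq1 => /andP[]; move: Q10 sP; rewrite -size_poly_gt0.
  by case: (size Q1) => [|[|[]]] //; case: (size P1) => [|[|[]]].
(* The coefficient of X in Q1(P1) = X + p B reads a' a = 1 + p B_1, hence the witness - B_1 for
   [c]. *)
exists P1`_1, P1`_0, Q1`_1, (- B`_1), P2; split.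
  rewrite EP; congr (_ + _); apply/polyP => k; rewrite coefD coefZ coefX coefC.
  case: k => [|[|k]] /=; rewrite ?mulr0 ?mulr1 ?add0r ?addr0 //.
  by rewrite nth_default // sP2.
have := coefE 1%N.
have -> : (Q1 \Po P1)`_1 = lead_coef (Q1 \Po P1) by rewrite /lead_coef sQP.
rewrite lead_coef_comp // !lead_coefE sQ sP2 expr1 /= => E.
by rewrite mulrC E; ring.
Qed.

End Primes.

(** * Descent along one prime *)

Definition pt (S : Type) (x y : S) : 'I_2 -> S := fun i => if i == 0 then x else y.

Lemma ord2_ind (P : 'I_2 -> Prop) : P 0 -> P 1 -> forall i, P i.
Proof.
move=> P0 P1 i; case: (unliftP 0 i) => [j|] -> //.
by rewrite (ord1 j) (_ : lift _ _ = 1) //; apply: val_inj.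
Qed.

Lemma pt_eta (S : Type) (x : 'I_2 -> S) : pt (x 0) (x 1) =1 x.
Proof. by apply: ord2_ind. Qed.

Lemma mmap_pt_id (R : comNzRingType) (p : {mpoly R[2]}) :
  mmap (@mpolyC 2 R) (pt 'X_0 'X_1) p = p.
Proof.
by rewrite -[RHS]mmap_id; apply: eq_mmap => //; exact: (pt_eta (fun i : 'I_2 => 'X_i)).
Qed.

Lemma polymap2P (R : nzRingType) (F G : polymap R 2) :
  tnth F 0 = tnth G 0 -> tnth F 1 = tnth G 1 -> F = G.
Proof. by move=> e0 e1; apply: eq_from_tnth; apply: ord2_ind. Qed.

Definition delta (R : comNzRingType) (p : R) : polymap R 2 :=
  [tuple 'X_0; p%:MP * 'X_1].

Lemma act_delta (R S : comNzRingType) (f : {rmorphism R -> S}) (p : R) x :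
  pm_act f (delta p) x =1 pt (x 0) (f p * x 1).
Proof.
by apply: ord2_ind; rewrite /pm_act /tnth /= ?rmorphM /= ?mmapC mmap_var.
Qed.

(** * Maps changing only the three variables Y_0, Y_1 and L *)

Section Slots.
Variables (R : idomainType) (m : nat).
Local Notation N := (2 + m)%N.
Local Notation S := {mpoly R[N.+1]}.
Local Notation C := (@mpolyC N.+1 R).
Local Notation L := (@ord_max N).
Local Notation s0 := (lift L (lshift m 0)).
Local Notation s1 := (lift L (lshift m 1)).

Definition slot_pt (x y l : S) : 'I_N.+1 -> S :=
  fun i => if i == L then l else if i == s0 then x else if i == s1 then y else 'X_i.

Definition slot_map (x y l : S) : polymap R N.+1 := [tuple slot_pt x y l i | i < N.+1].

Lemma slot_neq : [/\ s0 != L, s1 != L & s1 != s0].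
Proof.
by split; rewrite 1?eq_sym ?neq_lift // (inj_eq lift_inj) (inj_eq (@lshift_inj _ _)).
Qed.

Lemma slot_ptL x y l : slot_pt x y l L = l.
Proof. by rewrite /slot_pt eqxx. Qed.

Lemma slot_pt0 x y l : slot_pt x y l s0 = x.
Proof. by have [n0 n1 n2] := slot_neq; rewrite /slot_pt (negbTE n0) eqxx. Qed.

Lemma slot_pt1 x y l : slot_pt x y l s1 = y.
Proof.
by have [n0 n1 n2] := slot_neq; rewrite /slot_pt (negbTE n1) (negbTE n2) eqxx.
Qed.

Lemma mmap_cst (z : 'I_N.+1 -> S) c : mmap C z c%:MP = c%:MP.
Proof. exact: mmapC. Qed.

Definition slotE := (slot_ptL, slot_pt0, slot_pt1).

Lemma slot_comp a b c x y l :
  pm_comp (slot_map a b c) (slot_map x y l) =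
  slot_map (mmap C (slot_pt x y l) a) (mmap C (slot_pt x y l) b)
           (mmap C (slot_pt x y l) c).
Proof.
apply: eq_from_tnth => i; rewrite tnth_comp /pm_act !tnth_mktuple.
transitivity (mmap C (slot_pt x y l) (slot_pt a b c i)).
  by apply: eq_mmap => // j; rewrite tnth_mktuple.
rewrite {2}/slot_pt [in RHS]/slot_pt; do !case: ifP => //.
by move=> i1 i0 iL; rewrite mmap_var /slot_pt i1 i0 iL.
Qed.

Local Notation X0 := ('X_s0 : S).
Local Notation X1 := ('X_s1 : S).
Local Notation XL := ('X_L : S).

Lemma mmap_pt_slot (e : {mpoly R[2]}) (u v : S) (z : 'I_N.+1 -> S) :
  mmap C z (mmap C (pt u v) e) = mmap C (pt (mmap C z u) (mmap C z v)) e.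
Proof.
rewrite (rmorph_mmap (mmap C z)); apply: eq_mmap => [c|]; first by rewrite /= mmapC.
by apply: ord2_ind.
Qed.

Lemma tame_slotL f : mmap C (slot_pt X0 X1 0) f = f -> tame (slot_map X0 X1 (XL + f)).
Proof.
move=> ef; apply: (@tame_elementary _ _ L f) => [||j jL].
- rewrite -[RHS]ef; apply: eq_mmap => // j; rewrite /slot_pt.
  by case: (j == L) => //; do 2![case: eqP => [->//|_ //]].
- by rewrite tnth_mktuple slotE.
by rewrite tnth_mktuple /slot_pt (negbTE jL); do 2![case: eqP => [->//|_ //]].
Qed.

Lemma tame_slot0 f : mmap C (slot_pt 0 X1 XL) f = f -> tame (slot_map (X0 + f) X1 XL).
Proof.
have [n0 n1 n2] := slot_neq.
move=> ef; apply: (@tame_elementary _ _ s0 f) => [||j j0].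
- rewrite -[RHS]ef; apply: eq_mmap => // j; rewrite /slot_pt.
  case: (eqVneq j L) => [->|_]; first by rewrite eq_sym (negbTE n0).
  by case: (j == s0) => //; case: eqP => [->//|_ //].
- by rewrite tnth_mktuple slotE.
rewrite tnth_mktuple /slot_pt (negbTE j0).
by do 2![case: eqP => [->//|_ //]].
Qed.

Lemma tame_slot1 f : mmap C (slot_pt X0 0 XL) f = f -> tame (slot_map X0 (X1 + f) XL).
Proof.
have [n0 n1 n2] := slot_neq.
move=> ef; apply: (@tame_elementary _ _ s1 f) => [||j j1].
- rewrite -[RHS]ef; apply: eq_mmap => // j; rewrite /slot_pt.
  case: (eqVneq j L) => [->|_]; first by rewrite eq_sym (negbTE n1).
  case: (eqVneq j s0) => [->|_]; first by rewrite eq_sym (negbTE n2).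
  by case: (j == s1).
- by rewrite tnth_mktuple slotE.
rewrite tnth_mktuple /slot_pt (negbTE j1).
by do 2![case: eqP => [->//|_ //]].
Qed.

Lemma tame_slot_linear (a b c d a' b' c' d' s : R) :
  a * a' + b * c' = 1 -> a * b' + b * d' = 0 ->
  c * a' + d * c' = 0 -> c * b' + d * d' = 1 ->
  tame (slot_map (a%:MP * X0 + b%:MP * XL + s%:MP) X1 (c%:MP * X0 + d%:MP * XL)).
Proof.
move=> e11 e12 e21 e22; have [n0 n1 n2] := slot_neq.
apply: (@tame_linear2 _ _ s0 L a b c d a' b' c' d' s 0) => //.
- by rewrite tnth_mktuple slotE.
- by rewrite tnth_mktuple slotE mpolyC0 addr0.
move=> j /negbTE j0 /negbTE jL; rewrite tnth_mktuple /slot_pt j0 jL.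
by case: eqP => [->|].
Qed.

(** The last of the [m.+1] added variables is L, so the dilation parameter serves as the extra
    stabilizing variable. *)
Lemma pm_extendE (G : polymap R 2) :
  pm_extend m.+1 G =
  slot_map (mmap C (pt X0 X1) (tnth G 0)) (mmap C (pt X0 X1) (tnth G 1)) XL.
Proof.
apply: (@eq_from_tnth N.+1 S) => i.
rewrite [LHS](@tnth_mktuple (2 + m.+1)) tnth_mktuple.
have ptE j : mmap C (pt X0 X1) (tnth G j) =
    tnth G j \mPo [tuple 'X_(lshift m.+1 k) | k < 2].
  apply: eq_mmap => // k; rewrite tnth_mktuple; move: k; apply: ord2_ind;
    by rewrite /pt /=; congr 'X_ _; apply: val_inj; rewrite /= /bump leqNgt.
have [n0 n1 n2] := slot_neq.
case: splitP => [j|k] ij.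
  move: j ij; apply: ord2_ind => ij.
    have -> : i = s0 by apply: val_inj; apply: (etrans ij); rewrite /= /bump leqNgt.
    by rewrite slotE ptE.
  have -> : i = s1 by apply: val_inj; apply: (etrans ij); rewrite /= /bump leqNgt.
  by rewrite slotE ptE.
have -> : rshift 2 k = i by apply: val_inj; rewrite /= -ij.
rewrite /slot_pt; case: eqP => [->//|_].
rewrite ifF ?ifF //; apply/eqP => ei; move: ij; rewrite ei /= /bump leqNgt //.
Qed.

Lemma act_extend (G : polymap R 2) (z : 'I_N -> S) :
  (forall j, pm_act C (pm_extend m G) z (lshift m j) =
             mmap C (pt (z (lshift m 0)) (z (lshift m 1))) (tnth G j)) /\
  (forall k, pm_act C (pm_extend m G) z (rshift 2 k) = z (rshift 2 k)).
Proof.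
split=> [j|k]; rewrite /pm_act tnth_mktuple.
  have -> : lshift m j = unsplit (inl j) by [].
  rewrite unsplitK mmap_comp; apply: eq_mmap => // i.
  by rewrite tnth_mktuple mmap_var; move: i; apply: ord2_ind.
have -> : rshift 2 k = unsplit (inr k) by [].
by rewrite unsplitK mmap_var.
Qed.

(** The dilation of the extended [phi] is tame and contains [psi] evaluated at (L + p Y_0, Y_1).
    Changes of variables before and after it turn it into [psi] extended by one more variable. *)
Lemma tame_descent (p al be al' w : R) (e : {mpoly R[2]}) (phi psi : polymap R 2) :
  p != 0 -> al * al' + p * w = 1 ->
  tnth psi 0 = al%:MP * 'X_0 + be%:MP + p%:MP * e ->
  pm_comp phi (delta p) = pm_comp (delta p) psi ->
  tame (pm_extend m phi) -> tame (pm_extend m.+1 psi).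
Proof.
move=> p0 unit_al psi0 inter Tphi.
have phiE x y : pm_act C phi (pt x (p%:MP * y)) =1
    pt (mmap C (pt x y) (tnth psi 0)) (p%:MP * mmap C (pt x y) (tnth psi 1)).
  move=> i; rewrite -(act_delta C p (pm_act C psi (pt x y))) -pm_act_comp -inter.
  by rewrite pm_act_comp; apply: eq_pm_act => j; rewrite act_delta.
pose E x y := mmap C (pt x y) e; pose Q x y := mmap C (pt x y) (tnth psi 1).
have psi0E x y : mmap C (pt x y) (tnth psi 0) = al%:MP * x + be%:MP + p%:MP * E x y.
  by rewrite psi0 !rmorphD !rmorphM /= !mmapC mmap_var.
have phi0 x y : mmap C (pt x (p%:MP * y)) (tnth phi 0) =
    al%:MP * x + be%:MP + p%:MP * E x y by rewrite -psi0E; exact: (phiE x y 0).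
have phi1 x y : mmap C (pt x (p%:MP * y)) (tnth phi 1) = p%:MP * Q x y.
  exact: (phiE x y 1).
(* The base curve is (L, 0, ..., 0), on which the second coordinate is a multiple of [p], so that
   [phiE] applies. *)
pose a (j : 'I_N) : S := if j == lshift m 0 then XL else 0.
have pa j : param (a j).
  rewrite /a; case: ifP => _ t tL; last by rewrite rmorph0.
  by rewrite mmap_var.
(* This is (phi(L + p Y_0, p Y_1) - phi(L, 0)) / p computed through [psi]: the terms in al L and
   [be] cancel, and al p Y_0 leaves al Y_0. *)
pose T := slot_map (al%:MP * X0 + (E (XL + p%:MP * X0) X1 - E XL 0))
                   (Q (XL + p%:MP * X0) X1 - Q XL 0) XL.
have TT : tame T.
  apply: (tame_dilation p0 Tphi pa); split; first by rewrite tnth_mktuple slotE.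
  have a0 : a (lshift m 0) = XL by rewrite /a eqxx.
  have a1 : a (lshift m 1) = p%:MP * 0.
    by rewrite mulr0 /a (inj_eq (@lshift_inj _ _)).
  move=> i; rewrite -(splitK i); case: (split i) => [j|k] /=.
    rewrite !(act_extend _ _).1 a0 a1 -mulrDr add0r.
    move: j; apply: ord2_ind; rewrite tnth_mktuple slotE.
      by rewrite !phi0; move: XL X0 (E _ 0) (E _ X1) => *; ring.
    by rewrite !phi1; move: (Q _ 0) (Q _ X1) => *; ring.
  rewrite !(act_extend _ _).2 /a eq_rlshift add0r tnth_mktuple /slot_pt.
  rewrite eq_sym (negbTE (neq_lift _ _)) !(inj_eq lift_inj) !eq_rlshift.
  by rewrite add0r.
(* [M1], [M2] and [M3] prepare the point at which [T] is evaluated, [M5] and [M6] restore the terms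
   E(L, 0) and Q(L, 0) subtracted in [T], and [M7] recombines Y_0 and L. *)
pose M1 := slot_map X0 X1 (- XL).
pose M2 := slot_map X0 X1 (XL + (w%:MP * X0 - al'%:MP * E X0 X1)).
pose M3 := slot_map XL X1 (X0 - p%:MP * XL).
pose M5 := slot_map X0 (X1 + Q XL 0) XL.
pose M6 := slot_map (X0 + E XL 0) X1 XL.
pose M7 := slot_map (p%:MP * X0 + al%:MP * XL + be%:MP) X1 (- al'%:MP * X0 + w%:MP * XL).
have C_ring := (mpolyCN, mpolyC1, mpolyC0).
have T1 : tame M1.
  have -> : M1 = slot_map (1%:MP * X0 + 0%:MP * XL + 0%:MP) X1 (0%:MP * X0 + (-1)%:MP * XL).
    by congr slot_map; rewrite !C_ring; ring.
  by apply: (@tame_slot_linear _ _ _ _ 1 0 0 (-1)); ring.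
have T3 : tame M3.
  have -> : M3 = slot_map (0%:MP * X0 + 1%:MP * XL + 0%:MP) X1
      (1%:MP * X0 + (- p)%:MP * XL).
    by congr slot_map; rewrite !C_ring; ring.
  by apply: (@tame_slot_linear _ _ _ _ p 1 1 0); ring.
have T7 : tame M7.
  have -> : M7 = slot_map (p%:MP * X0 + al%:MP * XL + be%:MP) X1
      ((- al')%:MP * X0 + w%:MP * XL) by rewrite !C_ring.
  (* The matrix with rows (p, al) and (- al', w) has determinant al al' + p w = 1, so its inverse is
     its adjugate. *)
  apply: (@tame_slot_linear _ _ _ _ w (- al) al' p).
  + by rewrite -unit_al; ring.
  + by ring.
  + by ring.
  + by rewrite -unit_al; ring.
have T2 : tame M2.
  by apply: tame_slotL; rewrite !(rmorphB, rmorphM) /= !mmapC mmap_pt_slot !mmap_var !slotE.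
have T5 : tame M5.
  by apply: tame_slot1; rewrite mmap_pt_slot rmorph0 !mmap_var !slotE.
have T6 : tame M6.
  by apply: tame_slot0; rewrite mmap_pt_slot rmorph0 !mmap_var !slotE.
have -> : pm_extend m.+1 psi =
    pm_comp M7 (pm_comp M6 (pm_comp M5 (pm_comp T (pm_comp M3 (pm_comp M2 M1))))).
  rewrite pm_extendE psi0E -/(Q X0 X1).
  (* [eta] is chosen so that the last output of [M7], which is w Y_0 - al' E - (al al' + p w) eta,
     equals L. In the first output, the terms in p al eta cancel against al [lam]. *)
  pose eta := w%:MP * X0 - al'%:MP * E X0 X1 - XL; pose lam := X0 - p%:MP * eta.
  have -> : pm_comp M2 M1 = slot_map X0 X1 eta.
    rewrite slot_comp; congr slot_map; rewrite ?mmap_var ?slotE //.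
    by rewrite mmapD mmapB !mmapM !mmap_cst mmap_pt_slot !mmap_var !slotE addrC.
  have -> : pm_comp M3 (slot_map X0 X1 eta) = slot_map eta X1 lam.
    by rewrite slot_comp; congr slot_map; rewrite ?mmapB ?mmapM ?mmap_cst ?mmap_var ?slotE.
  (* M3 stores eta and lam in the slots of Y_0 and L, so that T, which evaluates psi
     at L + p Y_0, evaluates it at X0. *)
  have lamE : lam + p%:MP * eta = X0 by rewrite subrK.
  have -> : pm_comp T (slot_map eta X1 lam) =
      slot_map (al%:MP * eta + (E X0 X1 - E lam 0)) (Q X0 X1 - Q lam 0) lam.
    rewrite slot_comp; congr slot_map; last by rewrite mmap_var slotE.
      rewrite mmapD mmapB !mmap_pt_slot mmapD !mmapM mmap0 !mmap_cst !mmap_var !slotE.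
      by rewrite lamE.
    by rewrite mmapB !mmap_pt_slot mmapD !mmapM mmap0 !mmap_cst !mmap_var !slotE lamE.
  rewrite slot_comp mmapD mmap_pt_slot mmap0 !mmap_var !slotE subrK.
  rewrite slot_comp mmapD mmap_pt_slot mmap0 !mmap_var !slotE addrA subrK.
  rewrite slot_comp !mmapD !mmapM mmapN !mmap_cst !mmap_var !slotE.
  have uC : al%:MP * al'%:MP + p%:MP * w%:MP = 1 :> S.
    by rewrite -!mpolyCM -mpolyCD unit_al mpolyC1.
  congr slot_map; rewrite /lam.
  - by move: {lam lamE} eta X0 XL (E _ _) => *; ring.
  - transitivity (w%:MP * X0 - al'%:MP * E X0 X1 -
        (al%:MP * al'%:MP + p%:MP * w%:MP) * eta).
      by rewrite uC /eta; move: {eta lam lamE} X0 XL (E _ _) => *; ring.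
    by move: {lam lamE} eta X0 (E _ _) => *; ring.
by do !apply: tame_comp.
Qed.

End Slots.

(** * Descent along a product of primes *)

Section Delta.
Variable R : idomainType.

Local Notation C := (@mpolyC 2 R).
Local Notation X0 := ('X_0 : {mpoly R[2]}).
Local Notation X1 := ('X_1 : {mpoly R[2]}).

Lemma tnth_delta_comp (p : R) (F : polymap R 2) :
  tnth (pm_comp (delta p) F) 0 = tnth F 0 /\
  tnth (pm_comp (delta p) F) 1 = p%:MP * tnth F 1.
Proof. by rewrite !tnth_comp !act_delta. Qed.

Lemma tnth_comp_delta (p : R) (F : polymap R 2) i :
  tnth (pm_comp F (delta p)) i = mmap C (pt X0 (p%:MP * X1)) (tnth F i).
Proof. by rewrite tnth_comp; apply: eq_pm_act; apply: ord2_ind. Qed.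

Lemma deltaM (p q : R) : delta (p * q) = pm_comp (delta p) (delta q).
Proof.
have [E0 E1] := tnth_delta_comp p (delta q).
apply: polymap2P; rewrite ?E0 ?E1 /tnth /=; first by [].
by rewrite mpolyCM mulrA.
Qed.

Lemma delta1 : delta 1 = pm_id R 2.
Proof. by apply: polymap2P; rewrite tnth_mktuple /tnth /= ?mpolyC1 ?mul1r. Qed.

Lemma delta_inj (p : R) : p != 0 -> injective (pm_comp (delta p)).
Proof.
move=> p0 F G FG; have [e0 e1] := tnth_delta_comp p G.
rewrite -FG (tnth_delta_comp p F).1 in e0; rewrite -FG (tnth_delta_comp p F).2 in e1.
by apply: polymap2P => //; apply: mulfI e1; rewrite mpolyC_eq0.
Qed.

Lemma act_intertwined (S : comNzRingType) (f : {rmorphism R -> S}) (p : R)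
    (phi psi : polymap R 2) x y :
  pm_comp phi (delta p) = pm_comp (delta p) psi ->
  mmap f (pt x (f p * y)) (tnth phi 0) = mmap f (pt x y) (tnth psi 0) /\
  mmap f (pt x (f p * y)) (tnth phi 1) = f p * mmap f (pt x y) (tnth psi 1).
Proof.
move=> inter.
have E i : pm_act f phi (pt x (f p * y)) i =
    pt (pm_act f psi (pt x y) 0) (f p * pm_act f psi (pt x y) 1) i.
  rewrite -act_delta -pm_act_comp -inter pm_act_comp.
  by apply: eq_pm_act => j; rewrite act_delta.
by split; [exact: (E 0) | exact: (E 1)].
Qed.

Lemma mmap_pt_cong (S : comNzRingType) (f : {rmorphism R -> S}) (g : {mpoly R[2]})
  (c x y : S) : exists w, mmap f (pt x (c * y)) g = mmap f (pt x 0) g + c * w.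
Proof.
apply: (@mmap_cong _ _ f _ g c _ _ (pt 0 y)).
by apply: ord2_ind; rewrite /pt /= ?mulr0 ?addr0 ?add0r.
Qed.

Definition poly_in0 : {rmorphism {poly R} -> {mpoly R[2]}} :=
  horner_eval X0 \o map_poly C.

Lemma poly_in0C c : poly_in0 c%:P = c%:MP.
Proof. by rewrite /poly_in0 /= map_polyC horner_evalE hornerC. Qed.

Lemma poly_in0X : poly_in0 'X = X0.
Proof. by rewrite /poly_in0 /= map_polyX horner_evalE hornerX. Qed.

Lemma stably_tame_prime_descent (p : R) (phi phi' psi : polymap R 2) :
  prime_elt p -> pm_comp phi' phi = pm_id R 2 ->
  pm_comp phi (delta p) = pm_comp (delta p) psi ->
  stably_tame phi -> stably_tame psi.
Proof.
move=> p_prime phiK inter [m Tphi]; have [p0 _ _] := p_prime.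
pose P := mmap (@polyC R) (pt 'X 0) (tnth phi 0).
pose Q := mmap (@polyC R) (pt 'X 0) (tnth phi' 0).
(* The relation with [psi] makes the second coordinate of phi(X, 0) divisible by [p]. Hence
   phi'(phi(X, 0)) = (X, 0) gives, in the first coordinate, Q(P) = X modulo [p]. *)
have QP : pdivides p (Q \Po P - 'X).
  have [/esym PE p1E] := act_intertwined (@polyC R) 'X 0 inter.
  rewrite mulr0 in PE p1E; set c := mmap _ _ (tnth psi 1) in p1E.
  have [w ew] := mmap_pt_cong (@polyC R) (tnth phi' 0) p%:P P c.
  exists (- w); rewrite -mul_polyC mulrN; apply/eqP; rewrite subr_eq; apply/eqP.
  have <- : mmap (@polyC R) (pt P (p%:P * c)) (tnth phi' 0) = 'X.
    transitivity (pm_act (@polyC R) (pm_comp phi' phi) (pt 'X 0) 0).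
      rewrite pm_act_comp; apply: eq_pm_act; apply: ord2_ind => //.
    by rewrite phiK pm_act_id.
  rewrite ew addrC addrK /Q.
  rewrite (rmorph_mmap (comp_poly P)).
  apply: eq_mmap => [a|]; first by rewrite /= comp_polyC.
  by apply: ord2_ind; rewrite /pt /= ?comp_polyX ?comp_poly0.
have [a [b [a' [c [h [PE unit_a]]]]]] := invertible_mod_prime p_prime QP.
have [psi0 _] := act_intertwined C X0 X1 inter.
have [w ew] := mmap_pt_cong C (tnth phi 0) p%:MP X0 X1.
exists m.+1.
(* psi_1 = phi_1(X, pY) = P(X) + p w = a X + b + p (h + w). *)
apply: (tame_descent (al := a) (be := b) (e := poly_in0 h + w) p0 unit_a _ inter Tphi).
rewrite -[LHS]mmap_pt_id -psi0 ew mulrDr addrA; congr (_ + _).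
transitivity (poly_in0 P); last first.
  by rewrite PE -!mul_polyC !rmorphD !rmorphM !poly_in0C poly_in0X.
rewrite /P (rmorph_mmap poly_in0); apply: eq_mmap => [d|]; first by rewrite /= -poly_in0C.
apply: ord2_ind; first exact: esym poly_in0X.
by rewrite [RHS](rmorph0 poly_in0).
Qed.

(** The second coordinate of [phi] at (X, 0) is p r F_2(X, 0). Modulo [p] it does not change when 0
    is replaced by pY, so division by [p] remains possible. *)
Lemma intertwined_factor (p r : R) (phi F : polymap R 2) :
  pm_comp phi (delta (p * r)) = pm_comp (delta (p * r)) F ->
  exists psi, pm_comp phi (delta p) = pm_comp (delta p) psi.
Proof.
move=> inter; have [_ ] := act_intertwined C X0 0 inter.
rewrite mulr0 => E; have [w ew] := mmap_pt_cong C (tnth phi 1) p%:MP X0 X1.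
exists [tuple mmap C (pt X0 (p%:MP * X1)) (tnth phi 0);
              r%:MP * mmap C (pt X0 0) (tnth F 1) + w].
apply: polymap2P; rewrite ?(tnth_delta_comp _ _).1 ?(tnth_delta_comp _ _).2.
  by rewrite tnth_comp_delta.
by rewrite tnth_comp_delta ew E /= mpolyCM mulrDr mulrA.
Qed.

Lemma stably_tame_descent (s : seq R) (phi phi' F G : polymap R 2) :
  (forall p, p \in s -> prime_elt p) ->
  pm_comp phi phi' = pm_id R 2 -> pm_comp phi' phi = pm_id R 2 ->
  pm_comp F G = pm_id R 2 -> pm_comp G F = pm_id R 2 ->
  pm_comp phi (delta (\prod_(p <- s) p)) = pm_comp (delta (\prod_(p <- s) p)) F ->
  stably_tame phi -> stably_tame F.
Proof.
elim: s phi phi' => [|p s IHs] phi phi' s_prime phi1 phi2 FG GF.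
  by rewrite big_nil delta1 pm_1comp pm_comp1 => ->.
rewrite big_cons; set r := \prod_(q <- s) q => inter Tphi.
have p_prime : prime_elt p by apply: s_prime; rewrite mem_head.
have [p0 _ _] := p_prime.
(* The inverse [phi'] satisfies the same relation with [G], so it descends along [p] as well; this
   provides the inverse of [psi] required by the induction. *)
have inter' := intertwined_inv phi2 FG inter.
have [psi psiE] := intertwined_factor inter.
have [psi' psi'E] := intertwined_factor inter'.
have d_inj := delta_inj p0; rewrite deltaM in inter.
apply: (IHs psi psi' _ _ _ FG GF).
- by move=> q qs; apply: s_prime; rewrite inE qs orbT.
- exact: (intertwined_cancel d_inj psiE psi'E phi1).
- exact: (intertwined_cancel d_inj psi'E psiE phi2).
- exact: (intertwined_compl d_inj psiE inter).
exact: (stably_tame_prime_descent p_prime phi2 psiE Tphi).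
Qed.

End Delta.

(** * Common denominators *)

Lemma tofrac_surj (R : idomainType) (x : {fraction R}) :
  exists n d : R, d != 0 /\ tofrac d * x = tofrac n.
Proof.
elim/quotW: x => y; exists y.1, y.2; split; first exact: denom_ratioP.
unlock tofrac; rewrite -[LHS]FracField.pi_mul; apply/eqmodP.
rewrite /= FracField.equivfE /FracField.mulf.
rewrite !numer_Ratio ?denom_Ratio ?mul1r ?oner_neq0 ?denom_ratioP //.
by rewrite mulr1.
Qed.

Lemma coef_comp_scaleX (R : comNzRingType) (c : R) (h : {poly R}) i :
  (h \Po (c *: 'X))`_i = c ^+ i * h`_i.
Proof.
rewrite comp_polyE (eq_bigr (fun j : 'I_(size h) => (h`_j * c ^+ j) *: 'X^j)).
  rewrite -(poly_def _ (fun j => h`_j * c ^+ j)) coef_poly.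
  by case: ltnP => [_|hi]; [rewrite mulrC | rewrite nth_default ?mulr0].
by move=> j _; rewrite exprZn scalerA.
Qed.

Lemma scale_poly_inj (R : idomainType) (c : R) :
  c != 0 -> injective (fun A : {poly R} => c *: A).
Proof.
by move=> c0 A B /=; rewrite -!mul_polyC; apply: mulfI; rewrite polyC_eq0.
Qed.

Section Denominators.
Variable R : idomainType.

Local Notation K := (frac_field R).
Local Notation io := (@tofrac R : {rmorphism R -> K}).
Local Notation "A ^K" := (map_poly io A) (at level 2).

Lemma tofrac_inj : injective io.
Proof. by move=> x y /eqP; rewrite tofrac_eq => /eqP. Qed.

Lemma map_tofrac_inj : injective (map_poly io).
Proof. exact: map_inj_poly tofrac_inj (rmorph0 _). Qed.

Lemma clear_denominators (f : {poly K}) :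
  exists2 c, c != 0 & exists A : {poly R}, io c *: f = A^K.
Proof.
elim/poly_ind: f => [|f x [c c0 [A EA]]].
  by exists 1; rewrite ?oner_neq0 //; exists 0; rewrite scaler0 rmorph0.
have [n [d [d0 Ex]]] := tofrac_surj x.
exists (d * c); first by rewrite mulf_neq0.
exists ((d *: A) * 'X + (c * n)%:P).
rewrite rmorphD /= map_polyC [map_poly _ (_ * 'X)]rmorphM /= map_polyX map_polyZ /= -EA.
rewrite scalerDr; congr (_ + _); first by rewrite rmorphM scalerA scalerAl.
by rewrite -mul_polyC -polyCM; congr (polyC _); rewrite !rmorphM /= -Ex; ring.
Qed.

Definition clears (s : seq R) (f : {poly K}) (A : {poly R}) :=
  io (\prod_(p <- s) p) *: f = A^K.

(** Factor some denominator into primes and cancel those dividing the numerator; each cancellation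
    shortens the list. *)
Lemma reduced_denominator (f : {poly K}) : is_ufd R ->
  exists s A, [/\ forall p, p \in s -> prime_elt p, clears s f A &
                  forall p, p \in s -> ~ pdivides p A].
Proof.
move=> ufd; have [c c0 [A EA]] := clear_denominators f.
have [s [A' [s_prime {c c0 A EA} EA]]] :
    exists s A', (forall p, p \in s -> prime_elt p) /\ clears s f A'.
  have [Uc|/(ufd.1 _ c0)[s s_irr cE]] := boolP (c \is a GRing.unit); last first.
    exists s, A; rewrite /clears -cE; split=> // p ps.
    by apply: irreducible_prime ufd _; apply: s_irr.
  exists [::], (c^-1 *: A); rewrite /clears big_nil rmorph1 scale1r; split=> //.
  by rewrite map_polyZ /= -EA scalerA -rmorphM /= mulVr // rmorph1 scale1r.
have [n] := ubnP (size s); elim: n => // n IHn in s A' s_prime EA *; rewrite ltnS => sn.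
case: (classic (exists2 p, p \in s & pdivides p A')) => [[p ps [A EA']]|no]; last first.
  by exists s, A'; split=> // p ps pA; apply: no; exists p.
have p0 : p != 0 by have [] := s_prime p ps.
apply: (IHn (rem p s) A).
- by move=> q /mem_rem; apply: s_prime.
- have ip0 : io p != 0 by rewrite tofrac_eq0.
  apply: (scalerI ip0).
  by rewrite scalerA -rmorphM /= -map_polyZ -EA' -EA (big_rem p ps).
by rewrite size_rem //; case: (s) sn ps => //= *.
Qed.

(** This property is multiplicative in [c], which carries [pdivides_comp] from primes to products
    and powers. *)
Definition comp_detects (A : {poly R}) (c : R) :=
  c != 0 /\ forall H, pdivides c (H \Po A) -> pdivides c H.

Lemma comp_detects1 A : comp_detects A 1.
Proof. by split=> [|H _]; [rewrite oner_neq0 | exists H; rewrite scale1r]. Qed.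

Lemma comp_detectsM A c d : comp_detects A c -> comp_detects A d -> comp_detects A (c * d).
Proof.
move=> [c0 Dc] [d0 Dd]; split=> [|H [B EB]]; first by rewrite mulf_neq0.
have [|H1 EH] := Dc H; first by exists (d *: B); rewrite scalerA.
have [|H2 EH1] := Dd H1; last by exists H2; rewrite EH EH1 scalerA.
by exists B; apply: (scale_poly_inj c0); rewrite -comp_polyZ -EH EB scalerA.
Qed.

(** Write f = A / c in lowest terms. Integrality of g(A / c) forces c^i to divide the coefficient of
    X^i in [g], so g(X / c) has coefficients in [R]; it is [h]. *)
Lemma reduced_composite (f : {poly K}) (g B : {poly R}) : is_ufd R ->
  f.[0] = 0 -> g^K \Po f = B^K ->
  exists s A h, [/\ forall p, p \in s -> prime_elt p, clears s f A &
                    g = h \Po ((\prod_(p <- s) p) *: 'X)].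
Proof.
move=> ufd f0 gf; have [s [A [s_prime EA sA]]] := reduced_denominator f ufd.
exists s, A; set c := \prod_(p <- s) p.
have A0 : A.[0] = 0.
  apply: tofrac_inj; rewrite -horner_map rmorph0 -EA.
  by rewrite hornerZ f0 mulr0.
have Dc : comp_detects A c.
  rewrite /c; elim: (s) s_prime sA => [|p t IHt] t_prime tA.
    by rewrite big_nil; apply: comp_detects1.
  rewrite big_cons; apply: comp_detectsM; last first.
    by apply: IHt => q qt; [apply: t_prime|apply: tA]; rewrite inE qt orbT.
  have p_prime := t_prime p (mem_head _ _); split; first by case: p_prime.
  by move=> H; apply: pdivides_comp => //; apply: tA; rewrite mem_head.
have c0 := Dc.1; set d := size g.
have [_ Dcd] : comp_detects A (c ^+ d).
  elim: d => [|d IHd]; first exact: comp_detects1.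
  by rewrite exprS; apply: comp_detectsM.
(* H = c^d g(X / c) is integral because [d] exceeds the degree of [g]. As H(A) = c^d B, detection
   gives H = c^d h. *)
pose H := \sum_(i < d) (g`_i * c ^+ (d - i)) *: 'X^i.
have [|h Eh] := Dcd H.
  exists B; apply: map_tofrac_inj; rewrite map_polyZ /= -gf.
  rewrite map_comp_poly -EA [in RHS]comp_polyE size_map_inj_poly ?rmorph0 //; last first.
    exact: tofrac_inj.
  rewrite -/c -/d /H rmorph_sum /= linear_sum scaler_sumr; apply: eq_bigr => i _ /=.
  rewrite map_polyZ map_polyXn comp_polyZ comp_Xn_poly exprZn !scalerA coef_map /=.
  congr (_ *: _); rewrite !rmorphM !rmorphXn /= -mulrA -exprD subnK ?(ltnW (ltn_ord i)) //.
  by rewrite mulrC.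
exists h; split=> //; apply/polyP => i; rewrite coef_comp_scaleX.
have /(congr1 (fun q : {poly R} => q`_i)) := Eh.
rewrite coefZ /H -(poly_def d (fun i => g`_i * c ^+ (d - i))) coef_poly.
case: ltnP => [id Ei|di /esym/eqP]; last first.
  by rewrite mulf_eq0 expf_eq0 (negbTE c0) andbF /= => /eqP ->; rewrite nth_default ?mulr0.
apply: (mulfI (expf_neq0 (d - i) c0)).
by rewrite mulrC Ei mulrA -exprD subnK // ltnW.
Qed.

(** First write g = h1(c1 X) with [c1] a denominator of [f1]. Then h1(c1 f2) = g(f2) is integral, so
    the same argument applies to [h1] and c1 f2, and the two denominators multiply. *)
Lemma common_denominator (f1 f2 : {poly K}) (g B1 B2 : {poly R}) : is_ufd R ->
  f1.[0] = 0 -> f2.[0] = 0 -> g^K \Po f1 = B1^K -> g^K \Po f2 = B2^K ->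
  exists s A1 A2 h, [/\ forall p, p \in s -> prime_elt p, clears s f1 A1, clears s f2 A2 &
                    g = h \Po ((\prod_(p <- s) p) *: 'X)].
Proof.
move=> ufd f10 f20 gf1 gf2.
have [s1 [A1 [h1 [s1_prime EA1 Eg]]]] := reduced_composite ufd f10 gf1.
set c1 := \prod_(p <- s1) p in EA1 Eg.
have [||s2 [A2 [h2 [s2_prime EA2 Eh1]]]] :=
  @reduced_composite (io c1 *: f2) h1 B2 ufd; first by rewrite hornerZ f20 mulr0.
  by rewrite -gf2 Eg map_comp_poly map_polyZ map_polyX -comp_polyA comp_polyZ comp_polyX.
set c2 := \prod_(p <- s2) p in EA2 Eh1.
exists (s1 ++ s2), (c2 *: A1), A2, h2; rewrite /clears big_cat /= -/c1 -/c2; split.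
- by move=> p; rewrite mem_cat => /orP[/s1_prime|/s2_prime].
- by rewrite map_polyZ -EA1 scalerA -rmorphM /= mulrC.
- by rewrite -EA2 scalerA -rmorphM /= mulrC.
by apply/polyP => i; rewrite Eg Eh1 !coef_comp_scaleX exprMn mulrA.
Qed.

End Denominators.

(** * Three shears *)

Section Shears.
Variable R : comNzRingType.

Local Notation C := (@mpolyC 2 R).
Local Notation X0 := ('X_0 : {mpoly R[2]}).
Local Notation X1 := ('X_1 : {mpoly R[2]}).

Definition shearY (f : {poly R}) : polymap R 2 := [tuple X0; X1 + (map_poly C f).[X0]].
Definition shearX (f : {poly R}) : polymap R 2 := [tuple X0 + (map_poly C f).[X1]; X1].

Lemma mmap_horner (S : comNzRingType) (u : {rmorphism R -> S}) (z : 'I_2 -> S) f q :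
  mmap u z (map_poly C f).[q] = (map_poly u f).[mmap u z q].
Proof.
rewrite -(horner_map (mmap u z)) -map_poly_comp; congr (_.[_]).
by apply: eq_map_poly => c; rewrite /= mmapC.
Qed.

Section Act.
Variables (S : comNzRingType) (u : {rmorphism R -> S}).

Lemma act_shearY f x y :
  pm_act u (shearY f) (pt x y) =1 pt x (y + (map_poly u f).[x]).
Proof.
by apply: ord2_ind; rewrite /pm_act /tnth /= ?rmorphD /= ?mmap_horner !mmap_var.
Qed.

Lemma act_shearX f x y :
  pm_act u (shearX f) (pt x y) =1 pt (x + (map_poly u f).[y]) y.
Proof.
by apply: ord2_ind; rewrite /pm_act /tnth /= ?rmorphD /= ?mmap_horner !mmap_var.
Qed.

Definition shear3 f1 g f2 := pm_comp (shearY f2) (pm_comp (shearX g) (shearY f1)).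

Lemma act_shear3 f1 g f2 x y : let y1 := y + (map_poly u f1).[x] in
  let x1 := x + (map_poly u g).[y1] in
  pm_act u (shear3 f1 g f2) (pt x y) =1 pt x1 (y1 + (map_poly u f2).[x1]).
Proof.
move=> y1 x1 i; rewrite pm_act_comp -act_shearY; apply: eq_pm_act => {}i.
rewrite pm_act_comp -act_shearX; apply: eq_pm_act => {}i.
exact: act_shearY.
Qed.

End Act.

Lemma polymap_act_inj (F G : polymap R 2) :
  pm_act C F (pt X0 X1) =1 pm_act C G (pt X0 X1) -> F = G.
Proof.
move=> FG; apply: eq_from_tnth => i; rewrite -[LHS]mmap_id -[RHS]mmap_id.
have := FG i; rewrite /pm_act.
by congr (_ = _); apply: eq_mmap => //; apply: ord2_ind.
Qed.

Lemma shearYD f g : pm_comp (shearY f) (shearY g) = shearY (f + g).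
Proof.
apply: polymap_act_inj => i; rewrite pm_act_comp act_shearY.
rewrite (eq_pm_act _ _ (act_shearY _ _ _ _)) act_shearY.
by rewrite rmorphD hornerD -addrA [X in _ + X]addrC.
Qed.

Lemma shearXD f g : pm_comp (shearX f) (shearX g) = shearX (f + g).
Proof.
apply: polymap_act_inj => i; rewrite pm_act_comp act_shearX.
rewrite (eq_pm_act _ _ (act_shearX _ _ _ _)) act_shearX.
by rewrite rmorphD hornerD -addrA [X in _ + X]addrC.
Qed.

Lemma shear0 : shearY 0 = pm_id R 2 /\ shearX 0 = pm_id R 2.
Proof.
by split; apply: polymap2P; rewrite tnth_mktuple /tnth /= ?rmorph0 ?horner0 ?addr0.
Qed.

Lemma shear3K f1 g f2 : exists G,
  pm_comp (shear3 f1 g f2) G = pm_id R 2 /\ pm_comp G (shear3 f1 g f2) = pm_id R 2.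
Proof.
have [Y0 X0'] := shear0.
have YK f : pm_comp (shearY f) (shearY (- f)) = pm_id R 2 by rewrite shearYD subrr.
have YK' f : pm_comp (shearY (- f)) (shearY f) = pm_id R 2 by rewrite shearYD addNr.
have XK f : pm_comp (shearX f) (shearX (- f)) = pm_id R 2 by rewrite shearXD subrr.
have XK' f : pm_comp (shearX (- f)) (shearX f) = pm_id R 2 by rewrite shearXD addNr.
exists (pm_comp (shearY (- f1)) (pm_comp (shearX (- g)) (shearY (- f2)))); split.
  rewrite -!pm_compA (pm_compA (shearY f1)) YK pm_1comp.
  by rewrite (pm_compA (shearX g)) XK pm_1comp YK.
rewrite -!pm_compA (pm_compA (shearY (- f2))) YK' pm_1comp.
by rewrite (pm_compA (shearX (- g))) XK' pm_1comp YK'.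
Qed.

End Shears.

Lemma pm_extend0 (R : comNzRingType) (F : polymap R 2) : pm_extend 0 F = F.
Proof.
apply: (@eq_from_tnth 2 {mpoly R[2]}) => i.
rewrite [LHS](@tnth_mktuple (2 + 0)); case: splitP => [j ij|[] //].
have -> : i = j by apply: val_inj.
by rewrite -[RHS]comp_mpoly_id; apply: eq_mmap.
Qed.

Lemma tame_shear3 (R : comUnitRingType) (f1 g f2 : {poly R}) : tame (shear3 f1 g f2).
Proof.
have TY (f : {poly R}) : tame (shearY f).
  apply: (@tame_elementary R 2 1 (map_poly (@mpolyC 2 R) f).['X_0]) => //.
  - by rewrite mmap_horner mmap_var.
  - by apply: ord2_ind.
have TX (f : {poly R}) : tame (shearX f).
  apply: (@tame_elementary R 2 0 (map_poly (@mpolyC 2 R) f).['X_1]) => //.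
  - by rewrite mmap_horner mmap_var.
  - by apply: ord2_ind.
by do !apply: tame_comp.
Qed.

(** * Three shears over the fraction field *)

Section Core.
Variable R : idomainType.

Local Notation K := (frac_field R).
Local Notation io := (@tofrac R : {rmorphism R -> K}).
Local Notation "A ^K" := (map_poly io A) (at level 2).

Lemma tnth_frac (F : polymap R 2) i : tnth (pm_frac F) i = map_mpoly io (tnth F i).
Proof. exact: tnth_mktuple. Qed.

Lemma act_frac (S : comNzRingType) (u : {rmorphism K -> S}) (F : polymap R 2) x i :
  pm_act u (pm_frac F) x i = mmap (u \o io) x (tnth F i).
Proof.
rewrite /pm_act tnth_frac /map_mpoly (rmorph_mmap (mmap u x)).
by apply: eq_mmap => [c|j] /=; rewrite ?mmapC ?mmap_var.
Qed.

Lemma act_frac_poly (F : polymap R 2) (x : 'I_2 -> {poly R}) i :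
  pm_act (@polyC K) (pm_frac F) (map_poly io \o x) i = (mmap (@polyC R) x (tnth F i))^K.
Proof.
rewrite act_frac (rmorph_mmap (map_poly io)); apply: eq_mmap => // c.
by rewrite /= map_polyC.
Qed.

Lemma pm_frac_inj : injective (@pm_frac R 2).
Proof.
move=> F G FG; apply: eq_from_tnth => i; apply/mpolyP => m.
have E : map_mpoly io (tnth F i) = map_mpoly io (tnth G i) by rewrite -!tnth_frac FG.
by apply: (@tofrac_inj R); rewrite -!(mcoeff_map_mpoly io) E.
Qed.

Lemma pm_frac_comp (F G : polymap R 2) :
  pm_frac (pm_comp F G) = pm_comp (pm_frac F) (pm_frac G).
Proof.
apply: eq_from_tnth => i.
rewrite [LHS]tnth_frac [RHS]tnth_comp (act_frac (@mpolyC 2 K)) tnth_comp /pm_act.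
rewrite (rmorph_mmap (map_mpoly io)); apply: eq_mmap => [c|j] /=.
  by rewrite map_mpolyC.
by rewrite tnth_mktuple.
Qed.

Lemma pm_frac_id : pm_frac (pm_id R 2) = pm_id K 2.
Proof. by apply: eq_from_tnth => i; rewrite [LHS]tnth_frac !tnth_mktuple map_mpolyX. Qed.

Lemma pm_frac_delta c : pm_frac (delta c) = delta (io c).
Proof.
by apply: polymap2P; rewrite [LHS]tnth_frac /tnth /= ?rmorphM /= ?map_mpolyC map_mpolyX.
Qed.

Lemma map_mpoly_horner (f : {poly R}) (i : 'I_2) :
  map_mpoly io (map_poly (@mpolyC 2 R) f).['X_i] = (map_poly (@mpolyC 2 K) f^K).['X_i].
Proof.
rewrite -(horner_map (map_mpoly io)) -!map_poly_comp [X in _.[X]]map_mpolyX.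
congr (_.[_]).
by apply: eq_map_poly => c; rewrite /= map_mpolyC.
Qed.

Lemma pm_frac_shearY (f : {poly R}) : pm_frac (shearY f) = shearY f^K.
Proof.
apply: polymap2P; rewrite [LHS]tnth_frac; first exact: map_mpolyX.
transitivity (map_mpoly io ('X_1 + (map_poly (@mpolyC 2 R) f).['X_0])) => //.
by rewrite rmorphD [X in X + _]map_mpolyX [X in _ + X]map_mpoly_horner.
Qed.

Lemma pm_frac_shearX (f : {poly R}) : pm_frac (shearX f) = shearX f^K.
Proof.
apply: polymap2P; rewrite [LHS]tnth_frac; last exact: map_mpolyX.
transitivity (map_mpoly io ('X_0 + (map_poly (@mpolyC 2 R) f).['X_1])) => //.
by rewrite rmorphD [X in X + _]map_mpolyX [X in _ + X]map_mpoly_horner.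
Qed.

Lemma pm_frac_shear3 (f1 g f2 : {poly R}) :
  pm_frac (shear3 f1 g f2) = shear3 f1^K g^K f2^K.
Proof. by rewrite /shear3 !pm_frac_comp !pm_frac_shearY pm_frac_shearX. Qed.

Lemma stably_tame_shear3 (F G : polymap R 2) (f1 g f2 : {poly K}) : is_ufd R ->
  pm_comp F G = pm_id R 2 -> pm_comp G F = pm_id R 2 ->
  f1.[0] = 0 -> f2.[0] = 0 -> pm_frac F = shear3 f1 g f2 -> stably_tame F.
Proof.
move=> ufd FG GF f10 f20 EF.
have compE (f : {poly K}) (x : {poly K}) : (map_poly (@polyC K) f).[x] = f \Po x by [].
(* On the axis X = 0 the first shear acts trivially since f1(0) = 0, and the first coordinate of [F]
   is g(Y). *)
pose g0 := mmap (@polyC R) (pt 0 'X) (tnth F 0).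
have Eg : g = g0^K.
  rewrite -act_frac_poly EF.
  rewrite (eq_pm_act _ _ (y := pt 0 'X)); last first.
    by apply: ord2_ind; rewrite /= ?rmorph0 ?map_polyX.
  by rewrite act_shear3 /pt /= !compE comp_poly0r -horner_coef0 f10 addr0 add0r comp_polyXr.
(* On the axis Y = 0 the first coordinate of [F] is X + g(f1(X)). *)
pose B1 := mmap (@polyC R) (pt 'X 0) (tnth F 0) - 'X.
have gf1 : g0^K \Po f1 = B1^K.
  rewrite rmorphB /= map_polyX -[X in _ = X - _]act_frac_poly EF.
  rewrite (eq_pm_act _ _ (y := pt 'X 0)); last first.
    by apply: ord2_ind; [exact: map_polyX | exact: rmorph0].
  by rewrite act_shear3 /pt /= !compE add0r comp_polyXr Eg addrC addKr.
(* Let (u, v) = G(X, 0). Following F(u, v) = (X, 0) backwards, the second coordinate before the last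
   shear is - f2(X), so X = u + g(- f2(X)). *)
pose B2 := 'X - mmap (@polyC R) (pt 'X 0) (tnth G 0).
have gf2 : g0^K \Po (- f2) = B2^K.
  have ptX : map_poly io \o pt 'X 0 =1 pt 'X 0.
    by apply: ord2_ind; [exact: map_polyX | exact: rmorph0].
  have [u [v [uE Fuv]]] : exists u v, u = 'X - B2^K /\
      pm_act (@polyC K) (pm_frac F) (pt u v) =1 pt 'X 0.
    exists (pm_act (@polyC K) (pm_frac G) (pt 'X 0) 0).
    exists (pm_act (@polyC K) (pm_frac G) (pt 'X 0) 1); split.
      rewrite rmorphB /= map_polyX opprB [RHS]addrC subrK.
      by rewrite -[RHS]act_frac_poly (eq_pm_act _ _ ptX).
    move=> i; rewrite (eq_pm_act _ _ (pt_eta _)) -pm_act_comp -pm_frac_comp FG.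
    by rewrite pm_frac_id pm_act_id.
  have F0 := Fuv 0; have F1 := Fuv 1; rewrite EF !act_shear3 /pt /= !compE in F0 F1.
  rewrite F0 comp_polyXr in F1; move/eqP: F1; rewrite addr_eq0 => /eqP F1.
  rewrite F1 Eg uE -addrA -[RHS]addr0 in F0; move/addrI: F0 => /eqP.
  by rewrite addrC subr_eq0 => /eqP.
have [|s [A1 [A2 [h [s_prime EA1 EA2 Eh]]]]] :=
  common_denominator ufd f10 _ gf1 gf2; first by rewrite hornerN f20 oppr0.
set c := \prod_(p <- s) p in Eh; rewrite /clears -/c in EA1 EA2.
(* [phi] is the conjugate of [F] by (X, cY): both outer shears are multiplied by [c], with A1 = c f1
   and - A2 = c f2, while g(Y) = h(cY). All its data lie in [R]. *)
pose phi := shear3 A1 h (- A2).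
have [phi' [phi1 phi2]] := shear3K A1 h (- A2).
apply: (stably_tame_descent s_prime phi1 phi2 FG GF); last first.
  by exists 0%N; rewrite pm_extend0; apply: tame_shear3.
rewrite -/c; apply: pm_frac_inj; rewrite [LHS]pm_frac_comp [RHS]pm_frac_comp.
rewrite pm_frac_delta EF /phi pm_frac_shear3.
apply: polymap_act_inj => i.
rewrite [LHS]pm_act_comp [RHS]pm_act_comp (eq_pm_act _ _ (act_delta _ _ _)).
rewrite [LHS]act_shear3 [RHS]act_delta !act_shear3 rmorphN /= -EA1 -EA2 scalerN opprK.
rewrite !map_polyZ !hornerZ /pt /= -mulrDr.
have gE z : (map_poly (@mpolyC 2 K) g).[z] = (map_poly (@mpolyC 2 K) h^K).[(io c)%:MP * z].
  rewrite Eg Eh map_comp_poly map_polyZ map_polyX map_comp_poly map_polyZ map_polyX.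
  by rewrite horner_comp hornerZ hornerX.
by rewrite gE -mulrDr.
Qed.

End Core.

(** * Length three *)

Section Linear.
Variable R : comUnitRingType.

Definition lin2 (a b c d : R) : polymap R 2 :=
  [tuple a%:MP * 'X_0 + b%:MP * 'X_1; c%:MP * 'X_0 + d%:MP * 'X_1].

Lemma act_lin2 (S : comNzRingType) (u : {rmorphism R -> S}) a b c d x y :
  pm_act u (lin2 a b c d) (pt x y) =1 pt (u a * x + u b * y) (u c * x + u d * y).
Proof.
by apply: ord2_ind; rewrite /pm_act /tnth /= rmorphD !rmorphM /= !mmapC !mmap_var.
Qed.

Lemma pm_extend_comp m (F G : polymap R 2) :
  pm_extend m (pm_comp F G) = pm_comp (pm_extend m F) (pm_extend m G).
Proof.
apply: eq_from_tnth => i; rewrite [RHS]tnth_comp /pm_act !tnth_mktuple.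
case: (split i) => [j|k]; last first.
  by rewrite mmap_var tnth_mktuple -[rshift 2 k]/(unsplit (inr k)) unsplitK.
rewrite [tnth _ j]tnth_mktuple mmap_comp /comp_mpoly [LHS]mmap_comp.
apply: eq_mmap => // l; rewrite tnth_mktuple mmap_var tnth_mktuple.
by rewrite -[lshift m l]/(unsplit (inl l)) unsplitK.
Qed.

Lemma tame_extend_lin2 m a b c d a' b' c' d' :
  a * a' + b * c' = 1 -> a * b' + b * d' = 0 ->
  c * a' + d * c' = 0 -> c * b' + d * d' = 1 -> tame (pm_extend m (lin2 a b c d)).
Proof.
move=> e11 e12 e21 e22.
have tE j : tnth (pm_extend m (lin2 a b c d)) (lshift m j) =
    tnth (lin2 a b c d) j \mPo [tuple 'X_(lshift m k) | k < 2].
  by rewrite tnth_mktuple -[lshift m j]/(unsplit (inl j)) unsplitK.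
apply: (@tame_linear2 R _ (lshift m 0) (lshift m 1) a b c d a' b' c' d' 0 0) => //.
- by rewrite tE /tnth /= rmorphD !rmorphM /= !comp_mpolyC /comp_mpoly !mmap_var
    !tnth_mktuple mpolyC0 addr0.
- by rewrite tE /tnth /= rmorphD !rmorphM /= !comp_mpolyC /comp_mpoly !mmap_var
    !tnth_mktuple mpolyC0 addr0.
move=> l; rewrite -[l]splitK; case: (split l) => [j|k] /=.
  by move: j; apply: ord2_ind; rewrite eqxx.
by rewrite tnth_mktuple -[rshift 2 k]/(unsplit (inr k)) unsplitK.
Qed.

Lemma stably_tame_linl F a b c d a' b' c' d' :
  a * a' + b * c' = 1 -> a * b' + b * d' = 0 ->
  c * a' + d * c' = 0 -> c * b' + d * d' = 1 ->
  stably_tame F -> stably_tame (pm_comp (lin2 a b c d) F).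
Proof.
move=> e11 e12 e21 e22 [m Tm]; exists m; rewrite pm_extend_comp.
by apply: tame_comp => //; apply: tame_extend_lin2 e11 e12 e21 e22.
Qed.

Lemma stably_tame_linr F a b c d a' b' c' d' :
  a * a' + b * c' = 1 -> a * b' + b * d' = 0 ->
  c * a' + d * c' = 0 -> c * b' + d * d' = 1 ->
  stably_tame F -> stably_tame (pm_comp F (lin2 a b c d)).
Proof.
move=> e11 e12 e21 e22 [m Tm]; exists m; rewrite pm_extend_comp.
by apply: tame_comp => //; apply: tame_extend_lin2 e11 e12 e21 e22.
Qed.

Definition swap : polymap R 2 := lin2 0 1 1 0.

Lemma act_swap (S : comNzRingType) (u : {rmorphism R -> S}) x y :
  pm_act u swap (pt x y) =1 pt y x.
Proof. by move=> i; rewrite act_lin2 rmorph0 rmorph1 !mul0r !mul1r addr0 add0r. Qed.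

Lemma swapK : pm_comp swap swap = pm_id R 2.
Proof.
apply: polymap_act_inj => i; rewrite pm_act_comp (eq_pm_act _ _ (act_swap _ _ _)).
by rewrite act_swap pm_act_id.
Qed.

Lemma shearX_swap f : pm_comp (shearX f) swap = pm_comp swap (shearY f).
Proof.
apply: polymap_act_inj => i; rewrite [LHS]pm_act_comp [RHS]pm_act_comp.
rewrite (eq_pm_act _ _ (act_swap _ _ _)) (eq_pm_act _ _ (act_shearY _ _ _ _)).
by rewrite [LHS]act_shearX [RHS]act_swap.
Qed.

Lemma shearY_swap f : pm_comp (shearY f) swap = pm_comp swap (shearX f).
Proof.
apply: polymap_act_inj => i; rewrite [LHS]pm_act_comp [RHS]pm_act_comp.
rewrite (eq_pm_act _ _ (act_swap _ _ _)) (eq_pm_act _ _ (act_shearX _ _ _ _)).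
by rewrite [LHS]act_shearY [RHS]act_swap.
Qed.

Lemma shear3_swap f1 f2 f3 :
  pm_comp (shearX f3) (pm_comp (shearY f2) (shearX f1)) =
  pm_comp swap (pm_comp (shear3 f1 f2 f3) swap).
Proof.
rewrite /shear3 -(pm_compA (shearY f3)) -(pm_compA (shearX f2)) (shearY_swap f1).
rewrite (pm_compA (shearX f2)) (shearX_swap f2) -(pm_compA swap).
rewrite (pm_compA (shearY f3)) (shearY_swap f3) -(pm_compA swap).
by rewrite (pm_compA swap swap) swapK pm_1comp.
Qed.

Lemma stably_tame_swap_conj F :
  stably_tame F -> stably_tame (pm_comp swap (pm_comp F swap)).
Proof.
by move=> TF; apply: (stably_tame_linl (a' := 0) (b' := 1) (c' := 1) (d' := 0));
  try ring; apply: (stably_tame_linr (a' := 0) (b' := 1) (c' := 1) (d' := 0)); try ring.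
Qed.

End Linear.

Lemma ord2_inord : (inord 0 = 0 :> 'I_2) * (inord 1 = 1 :> 'I_2).
Proof. by split; apply: val_inj; rewrite /= inordK. Qed.

Lemma triangular0P (K : fieldType) (G : polymap K 2) :
  triangular0 G <-> exists2 f : {poly K}, f.[0] = 0 & G = shearY f \/ G = shearX f.
Proof.
rewrite /triangular0 !ord2_inord.
by split=> [[f [f0 Gf]]|[f f0 Gf]]; exists f.
Qed.

Lemma lin2_D1 (K : fieldType) (a : K) : lin2 a 0 0 1 = D1 a.
Proof.
rewrite /D1 !ord2_inord; apply: polymap2P; rewrite /tnth /=.
  by rewrite mpolyC0 mul0r addr0 mul_mpolyC.
by rewrite mpolyC0 mul0r add0r mpolyC1 mul1r.
Qed.

Lemma lin2_diagK (R : comUnitRingType) (a b : R) : a * b = 1 ->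
  pm_comp (lin2 a 0 0 1) (lin2 b 0 0 1) = pm_id R 2.
Proof.
move=> ab; apply: polymap_act_inj => i; rewrite pm_act_comp.
rewrite (eq_pm_act _ _ (act_lin2 _ _ _ _ _ _ _)) act_lin2 pm_act_id.
by rewrite rmorph0 rmorph1 !mul0r !mul1r !addr0 !add0r mulrA -rmorphM ab rmorph1 mul1r.
Qed.

(** * Chains of triangular maps over a field *)

Section Chains.
Variable K : fieldType.
Implicit Types (a b : K) (U V W : polymap K 2).

Lemma chain3 a U V W : chain a [:: U; V; W] = pm_comp (D1 a) (pm_comp U (pm_comp V W)).
Proof. by rewrite -[W in RHS]pm_comp1. Qed.

Lemma chain2 a U V : chain a [:: U; V] = pm_comp (D1 a) (pm_comp U V).
Proof. by rewrite -[V in RHS]pm_comp1. Qed.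

Lemma D1K a b U : b * a = 1 -> pm_comp (lin2 b 0 0 1) (pm_comp (D1 a) U) = U.
Proof. by move=> ba; rewrite -lin2_D1 pm_compA lin2_diagK // pm_1comp. Qed.

Lemma triangular0_merge (f g : {poly K}) : f.[0] = 0 -> g.[0] = 0 ->
  triangular0 (pm_comp (shearY f) (shearY g)) /\
  triangular0 (pm_comp (shearX f) (shearX g)).
Proof.
move=> f0 g0; rewrite shearYD shearXD.
by split; apply/triangular0P; exists (f + g); rewrite ?hornerD ?f0 ?g0 ?addr0; auto.
Qed.

(** Two adjacent shears in the same direction merge into one and would give a chain of two maps.
    Hence the directions alternate, and conjugation by the swap exchanges the two alternating
    patterns. *)
Lemma reduced_chain3 a (s : seq (polymap K 2)) :
  (forall T, T \in s -> triangular0 T) -> size s = 3%N ->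
  (forall U V, triangular0 U -> triangular0 V -> chain a [:: U; V] <> chain a s) ->
  exists f1 f2 f3 : {poly K}, [/\ f1.[0] = 0, f3.[0] = 0 &
    chain a s = pm_comp (D1 a) (shear3 f1 f2 f3) \/
    chain a s = pm_comp (D1 a) (pm_comp (swap K) (pm_comp (shear3 f1 f2 f3) (swap K)))].
Proof.
case: s => [|T3 [|T2 [|T1 []]]] // s_tri _ not2.
have [f1 f10 T1E] : exists2 f : {poly K}, f.[0] = 0 & T1 = shearY f \/ T1 = shearX f.
  by apply/triangular0P/s_tri; rewrite !inE eqxx !orbT.
have [f2 f20 T2E] : exists2 f : {poly K}, f.[0] = 0 & T2 = shearY f \/ T2 = shearX f.
  by apply/triangular0P/s_tri; rewrite !inE eqxx !orbT.
have [f3 f30 T3E] : exists2 f : {poly K}, f.[0] = 0 & T3 = shearY f \/ T3 = shearX f.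
  by apply/triangular0P/s_tri; rewrite !inE eqxx.
have T21 : ~ triangular0 (pm_comp T2 T1).
  move=> T; apply: (not2 T3 (pm_comp T2 T1) _ T); first by apply: s_tri; rewrite !inE eqxx.
  by rewrite chain2 chain3.
have T32 : ~ triangular0 (pm_comp T3 T2).
  move=> T; apply: (not2 (pm_comp T3 T2) T1 T).
    by apply: s_tri; rewrite !inE eqxx !orbT.
  by rewrite chain2 chain3 -[pm_comp (pm_comp T3 T2) T1]pm_compA.
have [Y32 X32] := triangular0_merge f30 f20; have [Y21 X21] := triangular0_merge f20 f10.
exists f1, f2, f3; split; [exact: f10 | exact: f30 | rewrite chain3].
case: T2E T21 T32 => -> T21 T32.
  case: T1E T21 => [-> /(_ Y21)[]|-> _].
  case: T3E T32 => [-> /(_ Y32)[]|-> _].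
  by right; rewrite shear3_swap.
case: T1E T21 => [-> _|-> /(_ X21)[]].
by case: T3E T32 => [-> _|-> /(_ X32)[]]; left.
Qed.

End Chains.

(** * Removing the diagonal factor and the swap over R *)

Section Lengths.
Variable R : idomainType.
Local Notation K := (frac_field R).
Local Notation io := (@tofrac R : {rmorphism R -> K}).

Lemma pm_frac_lin2 (a b c d : R) :
  pm_frac (lin2 a b c d) = lin2 (io a) (io b) (io c) (io d).
Proof.
have E (x y : R) : map_mpoly io (x%:MP_[2] * 'X_0 + y%:MP * 'X_1) =
    (io x)%:MP * 'X_0 + (io y)%:MP * 'X_1.
  by rewrite rmorphD !rmorphM /= !map_mpolyC !map_mpolyX.
by apply: polymap2P; rewrite [LHS]tnth_frac; exact: E.
Qed.

Lemma pm_frac_D1K (a : R) (F : polymap R 2) T : a \is a GRing.unit ->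
  pm_frac F = pm_comp (D1 (io a)) T ->
  pm_frac (pm_comp (lin2 a^-1 0 0 1) F) = T.
Proof.
move=> Ua EF; rewrite [LHS]pm_frac_comp EF pm_frac_lin2 rmorph0 rmorph1.
by apply: D1K; rewrite -rmorphM mulVr ?rmorph1.
Qed.

Lemma pm_frac_swapK (F : polymap R 2) T :
  pm_frac F = pm_comp (swap K) (pm_comp T (swap K)) ->
  pm_frac (pm_comp (swap R) (pm_comp F (swap R))) = T.
Proof.
have sE : pm_frac (swap R) = swap K by rewrite pm_frac_lin2 rmorph0 rmorph1.
move=> EF; rewrite [LHS]pm_frac_comp [X in pm_comp _ X]pm_frac_comp sE EF.
by rewrite -!pm_compA swapK pm_comp1 pm_compA swapK pm_1comp.
Qed.

Lemma stably_tame_swap (F : polymap R 2) :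
  stably_tame (pm_comp (swap R) (pm_comp F (swap R))) -> stably_tame F.
Proof.
set F' := pm_comp _ (pm_comp F _) => TF'.
have <- : pm_comp (swap R) (pm_comp F' (swap R)) = F.
  by rewrite -!pm_compA swapK pm_comp1 pm_compA swapK pm_1comp.
exact: stably_tame_swap_conj.
Qed.

Lemma stably_tame_D1 (a : R) (F : polymap R 2) : a \is a GRing.unit ->
  stably_tame (pm_comp (lin2 a^-1 0 0 1) F) -> stably_tame F.
Proof.
set F' := pm_comp _ F => Ua TF'.
have <- : pm_comp (lin2 a 0 0 1) F' = F by rewrite pm_compA lin2_diagK ?pm_1comp ?mulrV.
apply: (stably_tame_linl (a' := a^-1) (b' := 0) (c' := 0) (d' := 1)) TF'; try ring.
by rewrite mulrV // mul0r addr0.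
Qed.

End Lengths.

Theorem theorem4p1 (R : idomainType)
  (R_ufd : is_ufd R)
  (SL_eq_E : forall n m : nat, (3 <= m)%N ->
     forall A : 'M[{mpoly R[n]}]_m, SL A <-> EL A)
  (F : polymap R 2) :
  Lm 3 F -> stably_tame F.
Proof.
case=> [[[G FG GF] _] [a [s [Ua s3 s_tri EF]]] minimal].
(* A chain of two maps equal to this one would be a factorization of [F] of length 2, against the
   minimality of 3. *)
have not2 U V : triangular0 U -> triangular0 V ->
    chain (to_frac a) [:: U; V] <> chain (to_frac a) s.
  move=> U_tri V_tri UV; suff /minimal : length_factorization F 2 by [].
  exists a, [:: U; V]; split; [exact: Ua | exact: erefl | move=> T |].
    by rewrite !inE => /orP[/eqP->|/eqP->].
  by rewrite UV.
have [f1 [f2 [f3 [f10 f30 Es]]]] := reduced_chain3 s_tri s3 not2.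
(* As [a] is a unit of [R], the diagonal factor can be removed over [R], keeping an inverse pair for
   the shear argument. *)
pose D := lin2 a 0 0 1; pose D' := lin2 a^-1 0 0 1.
have DD' : pm_comp D D' = pm_id R 2 by apply: lin2_diagK; rewrite mulrV.
have D'D : pm_comp D' D = pm_id R 2 by apply: lin2_diagK; rewrite mulVr.
pose F' := pm_comp D' F; pose G' := pm_comp G D.
have FG' : pm_comp F' G' = pm_id R 2.
  by rewrite /F' /G' -pm_compA (pm_compA F) FG pm_1comp.
have GF' : pm_comp G' F' = pm_id R 2.
  by rewrite /F' /G' -pm_compA (pm_compA D) DD' pm_1comp.
apply: (stably_tame_D1 Ua).
case: Es => Es; have EF' := pm_frac_D1K Ua (etrans EF Es).
  exact: (stably_tame_shear3 R_ufd FG' GF' f10 f30 EF').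
(* In the other pattern the swap, which is defined over [R], conjugates both the map and its inverse
   to the first pattern. *)
have EF2 := pm_frac_swapK EF'; apply: stably_tame_swap.
have FG2 := involution_conj (swapK R) FG'; have GF2 := involution_conj (swapK R) GF'.
exact: (stably_tame_shear3 R_ufd FG2 GF2 f10 f30 EF2).
Qed.
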